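(* Let $k$ be a positive integer. Every simple permutation of length at least $2(2048k^8)^{(2048k^8)^{2k}}$ contains a proper pin sequence of length $2k$, a parallel alternation of length $2k$, or a wedge simple permutation of length $2k$.
   Context: An interval of a permutation $\pi$ of $[n]$ is a set of contiguous indices $I$ with $\pi(I)$ a set of consecutive integers; $\pi$ is simple if its only intervals have size $0$, $1$ or $n$. A permutation contains $\sigma$ if it has a subsequence order isomorphic to $\sigma$. Pin sequences are taken in the plot $\{(i,\pi(i)):i\in[n]\}$. For points $q_1,\dots,q_m$, $\operatorname{rect}(q_1,\dots,q_m)$ is the smallest closed axes-parallel rectangle containing them. A pin sequence (of length $m$) is a sequence of distinct points $p_1,\dots,p_m$ of the plot such that for each $i\ge3$, writing $\operatorname{rect}(p_1,\dots,p_{i-1})=[a,b]\times[c,d]$ and $p_i=(x,y)$: $p_i\notin\operatorname{rect}(p_1,\dots,p_{i-1})$ and either $a<x<b$ or $c<y<d$. Such $p_i$ is a left pin if $x<a$, right pin if $x>b$, up pin if $y>d$, down pin if $y<c$. The pin sequence is proper if (maximality) each $p_i$, $i\ge3$, is extreme in its direction among all points of the plot that could serve as a pin of that direction for $\operatorname{rect}(p_1,\dots,p_{i-1})$ (e.g. for a right pin $p_i=(x,y)$ there is no point of the plot in $(x,n]\times[c,d]$), and (separation) for each $i\ge2$ with $i+1\le m$, $p_{i+1}$ lies horizontally or vertically strictly between $\operatorname{rect}(p_1,\dots,p_{i-1})$ and $p_i$. A horizontal alternation is a permutation in which every entry with odd value lies to the left of every entry with even value, or the reverse of such; a vertical alternation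 is the inverse of a horizontal alternation, equivalently a permutation whose entries in odd positions are all smaller, or all larger, than its entries in even positions. A vertical alternation is parallel if its odd-position entries and even-position entries are both increasing or both decreasing; a horizontal alternation is parallel if its inverse is. Wedge simple permutations: a permutation $\tau$ of length $\ell\ge4$ is a basic type 1 wedge simple permutation if, among $\tau(1),\dots,\tau(\ell-1)$, the entries in odd positions are increasing, those in even positions are decreasing, every odd-position entry exceeds every even-position entry, and $\tau(\ell)$ is larger than all even-position entries and smaller than all odd-position entries among $\tau(1),\dots,\tau(\ell-1)$ (e.g. $7\,5\,8\,4\,9\,3\,10\,2\,11\,1\,12\,6$). A permutation $\tau$ of even length $\ell\ge4$ is a basic type 2 wedge simple permutation if $\tau(2)=\ell$, $\tau(3),\tau(5),\dots,\tau(\ell-1)$ are decreasing, $\tau(4),\tau(6),\dots,\tau(\ell)$ are increasing, and every $\tau(2j+1)$ ($j\ge1$) is less than $\tau(1)$, which is less than every $\tau(2j)$ ($j\ge2$) (e.g. $6\,12\,5\,7\,4\,8\,3\,9\,2\,10\,1\,11$). A wedge simple permutation is any permutation obtained from a basic type 1 or basic type 2 one by any composition of reversal, complementation ($\tau(i)\mapsto\ell+1-\tau(i)$) and inversion. *)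

(* Defs.v *)
From mathcomp Require Import all_boot all_fingroup.

Set Implicit Arguments.
Unset Strict Implicit.
Unset Printing Implicit Defensive.

(* A permutation of [n] = {1, ..., n} is an element of 'S_n, which acts on
   {0, ..., n-1}.  Positions and values are shifted back to 1, ..., n, so that
   parities and coordinates are the usual ones. *)
Definition pos n (i : 'I_n) : nat := i.+1.
Definition entry n (s : 'S_n) (i : 'I_n) : nat := (s i).+1.

Definition consecutive n (A : {set 'I_n}) : Prop :=
  exists a b : nat, A = [set i : 'I_n | a <= i < b].

Definition interval n (s : 'S_n) (I : {set 'I_n}) : Prop :=
  consecutive I /\ consecutive [set s i | i in I].

Definition simple_perm n (s : 'S_n) : Prop :=
  forall I : {set 'I_n}, interval s I -> [\/ #|I| = 0, #|I| = 1 | #|I| = n].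

Definition contains n m (s : 'S_n) (t : 'S_m) : Prop :=
  exists f : 'I_m -> 'I_n,
    (forall i j : 'I_m, i < j -> f i < f j) /\
    (forall i j : 'I_m, (s (f i) < s (f j)) = (t i < t j)).

Definition point : Type := nat * nat.

Definition plot n (s : 'S_n) : seq point := codom (fun i => (pos i, entry s i)).

Record rectangle :=
  Rectangle { xmin : nat; xmax : nat; ymin : nat; ymax : nat }.

(* Only meaningful on a nonempty sequence: the minima start from the
   coordinates of the first point. *)
Definition rect (q : seq point) : rectangle :=
  let q1 := head (0, 0) q in
  {| xmin := \big[minn/q1.1]_(r <- q) r.1;
     xmax := \max_(r <- q) r.1;
     ymin := \big[minn/q1.2]_(r <- q) r.2;
     ymax := \max_(r <- q) r.2 |}.

Definition in_rect (R : rectangle) (q : point) : bool :=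
  (xmin R <= q.1 <= xmax R) && (ymin R <= q.2 <= ymax R).

Definition is_pin (R : rectangle) (q : point) : bool :=
  ~~ in_rect R q && ((xmin R < q.1 < xmax R) || (ymin R < q.2 < ymax R)).

Inductive direction := Left | Right | Up | Down.

Definition outside (d : direction) (R : rectangle) (q : point) : bool :=
  match d with
  | Left => q.1 < xmin R
  | Right => xmax R < q.1
  | Up => ymax R < q.2
  | Down => q.2 < ymin R
  end.

Definition is_pin_of (d : direction) (R : rectangle) (q : point) : bool :=
  is_pin R q && outside d R q.

Definition further (d : direction) (q r : point) : bool :=
  match d with
  | Left => q.1 < r.1
  | Right => r.1 < q.1
  | Up => r.2 < q.2
  | Down => q.2 < r.2
  end.

(* r lies horizontally or vertically strictly between R and q *)
Definition separates (r : point) (R : rectangle) (q : point) : bool :=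
  [|| xmax R < r.1 < q.1, q.1 < r.1 < xmin R,
      ymax R < r.2 < q.2 | q.2 < r.2 < ymin R].

(* Sequences are 0-indexed: p_(j+1) is [nth (0, 0) p j], and
   rect(p_1, ..., p_j) is [rect (take j p)]. *)
Definition pin_sequence n (s : 'S_n) (p : seq point) : Prop :=
  [/\ uniq p, {subset p <= plot s}
    & forall j, 2 <= j < size p -> is_pin (rect (take j p)) (nth (0, 0) p j)].

Definition maximality n (s : 'S_n) (p : seq point) : Prop :=
  forall j d, 2 <= j < size p ->
    is_pin_of d (rect (take j p)) (nth (0, 0) p j) ->
    forall q, q \in plot s -> is_pin_of d (rect (take j p)) q ->
      ~~ further d q (nth (0, 0) p j).

Definition separation (p : seq point) : Prop :=
  forall j, 1 <= j -> j.+1 < size p ->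
    separates (nth (0, 0) p j.+1) (rect (take j p)) (nth (0, 0) p j).

Definition proper_pin_sequence n (s : 'S_n) (p : seq point) : Prop :=
  [/\ pin_sequence s p, maximality s p & separation p].

(* In 'S_n the product (s * t)%g is "s, then t" *)

Definition rev_perm n : 'S_n := perm (@rev_ord_inj n).
Definition reversal n (s : 'S_n) : 'S_n := (rev_perm n * s)%g.
Definition complementation n (s : 'S_n) : 'S_n := (s * rev_perm n)%g.

Definition increasing_on n (P : pred 'I_n) (s : 'S_n) : Prop :=
  forall i j : 'I_n, P i -> P j -> i < j -> s i < s j.
Definition decreasing_on n (P : pred 'I_n) (s : 'S_n) : Prop :=
  forall i j : 'I_n, P i -> P j -> i < j -> s j < s i.

Definition odd_left_of_even n (s : 'S_n) : Prop :=
  forall i j : 'I_n, odd (entry s i) -> ~~ odd (entry s j) -> i < j.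

Definition horizontal_alternation n (s : 'S_n) : Prop :=
  odd_left_of_even s \/
  exists t : 'S_n, odd_left_of_even t /\ s = reversal t.

Definition vertical_alternation n (s : 'S_n) : Prop :=
  exists t : 'S_n, horizontal_alternation t /\ s = (t^-1)%g.

Definition parallel_vertical_alternation n (s : 'S_n) : Prop :=
  let odd_pos := [pred i : 'I_n | odd (pos i)] in
  let even_pos := [pred i : 'I_n | ~~ odd (pos i)] in
  vertical_alternation s /\
  ((increasing_on odd_pos s /\ increasing_on even_pos s) \/
   (decreasing_on odd_pos s /\ decreasing_on even_pos s)).

Definition parallel_horizontal_alternation n (s : 'S_n) : Prop :=
  horizontal_alternation s /\ parallel_vertical_alternation (s^-1)%g.

Definition parallel_alternation n (s : 'S_n) : Prop :=
  parallel_vertical_alternation s \/ parallel_horizontal_alternation s.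

Definition basic_wedge_type1 l (t : 'S_l) : Prop :=
  let odd_pos := [pred i : 'I_l | odd (pos i) & pos i < l] in
  let even_pos := [pred i : 'I_l | ~~ odd (pos i) & pos i < l] in
  [/\ 4 <= l,
      increasing_on odd_pos t,
      decreasing_on even_pos t,
      (forall i j, odd_pos i -> even_pos j -> t j < t i)
    & forall e : 'I_l, pos e = l ->
        (forall j, even_pos j -> t j < t e) /\
        (forall i, odd_pos i -> t e < t i)].

Definition basic_wedge_type2 l (t : 'S_l) : Prop :=
  let odd_pos := [pred i : 'I_l | odd (pos i) & 3 <= pos i] in
  let even_pos := [pred i : 'I_l | ~~ odd (pos i) & 4 <= pos i] in
  [/\ 4 <= l /\ ~~ odd l,
      (forall i : 'I_l, pos i = 2 -> entry t i = l),
      decreasing_on odd_pos t,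
      increasing_on even_pos t
    & forall i : 'I_l, pos i = 1 ->
        (forall j, odd_pos j -> t j < t i) /\
        (forall j, even_pos j -> t i < t j)].

Inductive wedge_simple l : 'S_l -> Prop :=
  | Wedge_type1 t : basic_wedge_type1 t -> wedge_simple t
  | Wedge_type2 t : basic_wedge_type2 t -> wedge_simple t
  | Wedge_reversal t : wedge_simple t -> wedge_simple (reversal t)
  | Wedge_complementation t : wedge_simple t -> wedge_simple (complementation t)
  | Wedge_inversion t : wedge_simple t -> wedge_simple (t^-1)%g.

(* Main.v *)
(* All coordinates below may be flipped or exchanged, so one orientation suffices.
   Start with many disjoint pairs of points in adjacent columns.  By simplicity
   each pair begins a proper pin sequence that ends at the rightmost point; if
   all of these are shorter than 2k, then, read backwards, they form a tree of
   bounded depth, so some point x comes right after many different pins y.  Each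
   such y is separated by x from a rectangle, and maximality of the pins y forces
   the tops (or bottoms) of these rectangles to alternate with the y's across the
   line through x.  By Erdos-Szekeres this yields either a parallel alternation
   or a long wedge.  In the case of a wedge, follow a pin sequence from its tip to
   the extreme point in the direction in which it opens: fewer than 2k pins have
   to cross 2k^2 levels, so some pin crosses k levels at once, and together with
   these levels it forms a wedge simple permutation. *)

From Stdlib Require Import Classical.
Require Import Defs.
From mathcomp Require Import all_boot all_fingroup zify.

Set Implicit Arguments.
Unset Strict Implicit.
Unset Printing Implicit Defensive.

(** * Patterns of a point set, up to the symmetries of the square *)

(** Subtracting from the maximum keeps truncated subtraction strictly order-reversing; only the
    order of the values matters later. *)
Definition flip (T : finType) (X : T -> nat) (u : T) : nat :=
  \max_v X v - X u.

Lemma ltn_flip (T : finType) (X : T -> nat) u v :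
  (flip X u < flip X v) = (X v < X u).
Proof.
have hu := leq_bigmax (F := X) u; have hv := leq_bigmax (F := X) v.
rewrite /flip; lia.
Qed.

Lemma leq_flip (T : finType) (X : T -> nat) u v :
  (flip X u <= flip X v) = (X v <= X u).
Proof. by rewrite leqNgt ltn_flip -leqNgt. Qed.

Lemma flip_inj (T : finType) (X : T -> nat) : injective X -> injective (flip X).
Proof.
move=> injX u v e; apply: injX; apply/eqP.
by rewrite eqn_leq -(leq_flip X u v) -(leq_flip X v u) e leqnn.
Qed.

(* The plot of a permutation is handled through its two coordinate functions
   [X] and [Y], so that exchanging or flipping them gives all its symmetric
   copies. *)
Definition embeds (T : Type) (X Y : T -> nat) m (t : 'S_m) : Prop :=
  exists f : 'I_m -> T,
    (forall i j : 'I_m, i < j -> X (f i) < X (f j)) /\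
    (forall i j : 'I_m, (Y (f i) < Y (f j)) = (t i < t j)).

Definition has_target (T : Type) k (X Y : T -> nat) : Prop :=
  exists t : 'S_(2 * k), (parallel_alternation t \/ wedge_simple t) /\ embeds X Y t.

Lemma revE n (i : 'I_n) : rev_perm n i = rev_ord i.
Proof. by rewrite permE. Qed.

Lemma reversalE n (s : 'S_n) i : reversal s i = s (rev_ord i).
Proof. by rewrite permM revE. Qed.

Lemma complementationE n (s : 'S_n) i : complementation s i = rev_ord (s i).
Proof. by rewrite permM revE. Qed.

Lemma reversal_inv n (s : 'S_n) : reversal s = ((complementation s^-1)^-1)%g.
Proof.
have revV : ((rev_perm n)^-1)%g = rev_perm n.
  apply/eqP; rewrite eq_invg_mul; apply/eqP/permP => i.
  by rewrite permM !revE rev_ordK perm1.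
by rewrite /reversal /complementation invMg invgK revV.
Qed.

Lemma reversalK n : involutive (@reversal n).
Proof. by move=> s; apply/permP => i; rewrite !reversalE rev_ordK. Qed.

Definition odds_below n (s : 'S_n) : Prop :=
  forall i j : 'I_n, odd (pos i) -> ~~ odd (pos j) -> s i < s j.
Definition evens_below n (s : 'S_n) : Prop :=
  forall i j : 'I_n, odd (pos i) -> ~~ odd (pos j) -> s j < s i.

Lemma vertical_alternationP n (s : 'S_n) :
  vertical_alternation s <-> odds_below s \/ evens_below s.
Proof.
split.
  case=> t [[h|[r [h ->]]] ->].
    left=> i j oi oj; apply: h; by rewrite /entry permKV.
  right=> i j oi oj.
  have rinv u : ((reversal r)^-1)%g u = rev_ord ((r^-1)%g u).
    by apply: (@perm_inj _ (reversal r)); rewrite permKV reversalE rev_ordK permKV.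
  rewrite !rinv /=.
  have := h ((r^-1)%g i) ((r^-1)%g j); rewrite /entry !permKV => /(_ oi oj).
  have := ltn_ord ((r^-1)%g j); lia.
case=> h; exists (s^-1)%g; rewrite invgK; split=> //.
  by left=> i j oi oj; have := h ((s^-1)%g i) ((s^-1)%g j) oi oj; rewrite !permKV.
right; exists (reversal s^-1); rewrite reversalK; split=> // i j.
rewrite /entry !reversalE => oi oj.
have := h _ _ oi oj; rewrite !permKV /=.
have := ltn_ord i; have := ltn_ord j; lia.
Qed.

Lemma parallel_vertical_complementation n (s : 'S_n) :
  parallel_vertical_alternation s ->
  parallel_vertical_alternation (complementation s).
Proof.
have E i j : (complementation s i < complementation s j) = (s j < s i).
  rewrite !complementationE /=; have := ltn_ord (s i); have := ltn_ord (s j); lia.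
case=> /vertical_alternationP va h; split.
  apply/vertical_alternationP.
  by case: va => va; [right|left] => i j oi oj; rewrite E; apply: va.
by case: h => -[h1 h2]; [right|left]; split=> i j pi pj ij; rewrite E;
  [apply: h1|apply: h2|apply: h1|apply: h2].
Qed.

(** The length is even, so reversal exchanges odd and even positions. *)
Lemma parallel_vertical_reversal k (s : 'S_(2 * k)) :
  parallel_vertical_alternation s ->
  parallel_vertical_alternation (reversal s).
Proof.
have rp (i : 'I_(2 * k)) : odd (pos (rev_ord i)) = ~~ odd (pos i).
  rewrite /pos /=; have := ltn_ord i; lia.
have rl (i j : 'I_(2 * k)) : i < j -> rev_ord j < rev_ord i.
  by rewrite /=; have := ltn_ord i; have := ltn_ord j; lia.
case=> /vertical_alternationP va h; split.
  apply/vertical_alternationP.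
  by case: va => va; [right|left] => i j oi oj; rewrite !reversalE; apply: va;
    rewrite rp ?oj ?oi.
have r1 (i : 'I_(2 * k)) : odd (pos i) -> ~~ odd (pos (rev_ord i)).
  by rewrite rp negbK.
have r2 (i : 'I_(2 * k)) : ~~ odd (pos i) -> odd (pos (rev_ord i)).
  by rewrite rp.
case: h => -[h1 h2]; [right|left]; split=> i j pi pj ij; rewrite !reversalE.
- exact: h2 (r1 _ pj) (r1 _ pi) (rl _ _ ij).
- exact: h1 (r2 _ pj) (r2 _ pi) (rl _ _ ij).
- exact: h2 (r1 _ pj) (r1 _ pi) (rl _ _ ij).
- exact: h1 (r2 _ pj) (r2 _ pi) (rl _ _ ij).
Qed.

Lemma parallel_inversion n (s : 'S_n) :
  parallel_alternation s -> parallel_alternation (s^-1)%g.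
Proof.
case=> [h|[h1 h2]]; [right|by left].
split; last by rewrite invgK.
by case: h => -[t [ht ->]] _; rewrite invgK.
Qed.

Lemma parallel_horizontal_inv n (s : 'S_n) :
  parallel_vertical_alternation (s^-1)%g -> parallel_alternation s.
Proof. by move=> h; rewrite -[s]invgK; apply: parallel_inversion; left. Qed.

Lemma parallel_reversal k (s : 'S_(2 * k)) :
  parallel_alternation s -> parallel_alternation (reversal s).
Proof.
case=> [h|[_ h]]; first by left; apply: parallel_vertical_reversal.
apply: parallel_horizontal_inv.
by rewrite reversal_inv invgK; apply: parallel_vertical_complementation.
Qed.

(** * Invariance of the targets under symmetries, and standardization *)

Section TargetSymmetry.
Variables (T : finType) (k : nat).
Implicit Types X Y : T -> nat.

Lemma has_target_swap X Y : has_target k Y X -> has_target k X Y.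
Proof.
case=> t [ht [f [f1 f2]]]; exists (t^-1)%g; split.
  by case: ht => ht; [left; apply: parallel_inversion|right; apply: Wedge_inversion].
exists (fun i => f ((t^-1)%g i)); split=> i j.
  by move=> ij; rewrite f2 !permKV.
set u := (t^-1)%g i; set v := (t^-1)%g j.
case: (ltngtP u v) => [/f1 -> //|/f1|/val_inj ->]; last by rewrite ltnn.
by move=> h; apply/negbTE; rewrite -leqNgt ltnW.
Qed.

Lemma has_target_flipX X Y : has_target k (flip X) Y -> has_target k X Y.
Proof.
case=> t [ht [f [f1 f2]]]; exists (reversal t); split.
  by case: ht => ht; [left; apply: parallel_reversal|right; apply: Wedge_reversal].
exists (fun i => f (rev_ord i)); split=> i j; last by rewrite !reversalE.
move=> ij; rewrite -ltn_flip; apply: f1 => /=.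
have := ltn_ord i; have := ltn_ord j; lia.
Qed.

Lemma has_target_flipY X Y : has_target k X (flip Y) -> has_target k X Y.
Proof. by move/has_target_swap/has_target_flipX/has_target_swap. Qed.

(** Replacing each height by its rank [r i] among the chosen points turns them into a permutation
    with the same order. It then suffices to check the pattern on order relations alone. *)
Lemma has_target_standardization X Y (f : 'I_(2 * k) -> T) :
  injective Y -> (forall i j : 'I_(2 * k), i < j -> X (f i) < X (f j)) ->
  (forall t : 'S_(2 * k), (forall i j, (Y (f i) < Y (f j)) = (t i < t j)) ->
     parallel_alternation t \/ wedge_simple t) ->
  has_target k X Y.
Proof.
move=> injY incX ht; pose r i := #|[set j | Y (f j) < Y (f i)]|.
have r_lt i : r i < 2 * k.
  rewrite -[2 * k]card_ord -cardsT; apply: proper_card.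
  by rewrite properT; apply/negP => /eqP/setP/(_ i); rewrite !inE ltnn.
have r_mono i j : Y (f i) < Y (f j) -> r i < r j.
  move=> ij; apply: proper_card; apply/properP; split.
    by apply/subsetP => u; rewrite !inE => /ltn_trans; apply.
  by exists i; rewrite !inE ?ltnn.
have injf : injective f.
  move=> i j e; apply/val_inj.
  by case: (ltngtP i j) => // /incX; rewrite e ltnn.
have r_inj : injective (fun i => Ordinal (r_lt i)).
  move=> i j [e]; apply/injf/injY.
  by case: (ltngtP (Y (f i)) (Y (f j))) => // /r_mono; rewrite e ltnn.
have tE i j : (Y (f i) < Y (f j)) = (perm r_inj i < perm r_inj j).
  rewrite !permE /=.
  case: (ltngtP (Y (f i)) (Y (f j))) => [/r_mono -> //|/r_mono|/injY/injf ->].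
    by move/ltnW; rewrite leqNgt => /negbTE.
  by rewrite ltnn.
by exists (perm r_inj); split; [apply: ht|exists f].
Qed.

End TargetSymmetry.

(** * Wedges *)

(** The wedge opens to the right: [a 0], [b 0] form its tip, the [a i] descend and the [b i]
    ascend. *)
Definition wedge (T : Type) (X Y : T -> nat) m (a b : nat -> T) : Prop :=
  [/\ forall i, i < m -> X (a i) < X (b i),
      forall i j, i < j < m -> X (b i) < X (a j),
      forall i j, i < j < m -> Y (a j) < Y (a i),
      forall i j, i < j < m -> Y (b i) < Y (b j)
    & Y (a 0) < Y (b 0)].

Section Wedge.
Variables (T : finType) (X Y : T -> nat) (m : nat) (a b : nat -> T).
Hypotheses (injY : injective Y) (W : wedge X Y m a b).

Lemma wedge_aX i j : i < j < m -> X (a i) < X (a j).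
Proof.
case: W => h1 h2 _ _ _ ijm; have := h1 i; have := h2 _ _ ijm; lia.
Qed.

Lemma wedge_bX i j : i < j < m -> X (b i) < X (b j).
Proof.
case: W => h1 h2 _ _ _ ijm; have := h1 j; have := h2 _ _ ijm; lia.
Qed.

Lemma wedge_abX i j : i <= j < m -> X (a i) < X (b j).
Proof.
case: W => h1 h2 _ _ _ ijm; have := h1 j; case: (ltngtP i j) => ij; try lia.
  have := @wedge_aX i j; lia.
by rewrite ij; apply; lia.
Qed.

Lemma wedge_abY i j : i < m -> j < m -> Y (a i) < Y (b j).
Proof.
case: W => _ _ h3 h4 h5 im jm.
have h6 : Y (a i) <= Y (a 0).
  by case: (posnP i) => [-> //|ip]; have := h3 0 i; lia.
have h7 : Y (b 0) <= Y (b j).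
  by case: (posnP j) => [-> //|jp]; have := h4 0 j; lia.
lia.
Qed.

Lemma wedge_type1 k l p : 1 < k -> l + k < m ->
  X (a (l + k)) <= X p -> Y (a l) < Y p < Y (b l) -> has_target k X Y.
Proof.
move=> k1 lm Xp Yp.
case: (W) => h1 h2 h3 h4 _.
(* From left to right: [b l], [a (l+1)], [b (l+1)], ..., [b (l+k-1)], [p]. The lower arm starts one
   level later, so that upper points take the odd positions. *)
pose g i := if i == (2 * k).-1 then p else
            if odd i then a (l + uphalf i) else b (l + i./2).
have gp : g (2 * k).-1 = p by rewrite /g eqxx.
have ga i : odd i -> i < (2 * k).-1 -> g i = a (l + uphalf i).
  by move=> oi ik; rewrite /g oi; case: eqP => //; lia.
have gb i : ~~ odd i -> i < (2 * k).-1 -> g i = b (l + i./2).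
  by move=> /negbTE oi ik; rewrite /g oi; case: eqP => //; lia.
apply: (has_target_standardization (f := fun i : 'I_(2 * k) => g i)) => //.
  move=> i j ij; have jk := ltn_ord j.
  have ik : i < (2 * k).-1 by lia.
  have [jE|jk'] : j = (2 * k).-1 :> nat \/ j < (2 * k).-1 by lia.
    rewrite jE gp; apply: leq_trans Xp.
    case: (boolP (odd i)) => oi; [rewrite ga //|rewrite gb //].
      by apply: wedge_aX; lia.
    by apply: h2; lia.
  case: (boolP (odd i)) => oi; case: (boolP (odd j)) => oj;
    [rewrite (ga i) // (ga j)|rewrite (ga i) // (gb j)
    |rewrite (gb i) // (ga j)|rewrite (gb i) // (gb j)] => //.
  - by apply: wedge_aX; lia.
  - by apply: wedge_abX; lia.
  - by apply: h2; lia.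
  - by apply: wedge_bX; lia.
move=> t tE; right; apply: Wedge_type1; split.
- lia.
- move=> i j /andP[/= oi ik] /andP[/= oj jk] ij.
  rewrite /pos in ik jk; rewrite -tE gb ?gb //; try lia.
  by apply: h4; lia.
- move=> i j /andP[/= oi ik] /andP[/= oj jk] ij.
  rewrite /pos in ik jk; rewrite -tE ga ?ga //; try lia.
  by apply: h3; lia.
- move=> i j /andP[/= oi ik] /andP[/= oj jk].
  rewrite /pos in ik jk; rewrite -tE ga ?gb //; try lia.
  by apply: wedge_abY; lia.
move=> e; rewrite /pos => eE.
have {}eE : e = (2 * k).-1 :> nat by lia.
split=> [j /andP[/= oj jk]|i /andP[/= oi ik]]; rewrite -tE /= eE gp.
  rewrite /pos in jk; rewrite (ga j); try lia.
  have := h3 l (l + uphalf j); lia.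
rewrite /pos in ik; rewrite (gb i); try lia.
case: (posnP i./2) => [->|ip]; first by rewrite addn0; lia.
have := h4 l (l + i./2); lia.
Qed.

Lemma wedge_type2 k l u p : 1 < k -> l + k.-1 < m ->
  X u < X p < X (a l) -> Y (a l) < Y u < Y (b l) -> Y (b (l + k.-1)) <= Y p ->
  has_target k X Y.
Proof.
move=> k1 lm Xp Yu Yp.
case: (W) => h1 h2 h3 h4 _.
(* From left to right: [u], [p], [a l], [b l], ..., [a (l+k-2)], [b (l+k-2)]. *)
pose g i := if i == 0 then u else if i == 1 then p else
            if odd i then b (l + (i - 2)./2) else a (l + (i - 2)./2).
have gb i : odd i -> 1 < i -> g i = b (l + (i - 2)./2).
  by case: i => [|[|i]] //= oi _; rewrite /g /= oi.
have ga i : ~~ odd i -> 1 < i -> g i = a (l + (i - 2)./2).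
  by case: i => [|[|i]] //= /negbTE oi _; rewrite /g /= oi.
have Xal i : i + l < m -> X (a l) <= X (a (l + i)).
  by case: i => [|i] h; rewrite ?addn0 // ltnW // wedge_aX //; lia.
have Xbl i : i + l < m -> X (a l) <= X (b (l + i)).
  by move=> h; rewrite ltnW // wedge_abX //; lia.
have Yal i : i + l < m -> Y (a (l + i)) <= Y (a l).
  by case: i => [|i] h; rewrite ?addn0 // ltnW // h3 //; lia.
have Ybl i : i + l < m -> Y (b l) <= Y (b (l + i)).
  by case: i => [|i] h; rewrite ?addn0 // ltnW // h4 //; lia.
apply: (has_target_standardization (f := fun i : 'I_(2 * k) => g i)) => //.
  move=> i j ij; have jk := ltn_ord j.
  have [j1|j2] : j = 1 :> nat \/ 1 < j by lia.
    by rewrite j1 (_ : i = 0 :> nat) /=; [rewrite /g /=; lia|lia].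
  have Xj : X (a l) <= X (g j).
    case: (boolP (odd j)) => oj; [rewrite gb //|rewrite ga //].
      by apply: Xbl; lia.
    by apply: Xal; lia.
  have [i0|[i1|i2]] : i = 0 :> nat \/ i = 1 :> nat \/ 1 < i by lia.
  - by rewrite i0 {1}/g /=; lia.
  - by rewrite i1 {1}/g /=; lia.
  case: (boolP (odd i)) => oi; case: (boolP (odd j)) => oj;
    [rewrite (gb i) // (gb j)|rewrite (gb i) // (ga j)
    |rewrite (ga i) // (gb j)|rewrite (ga i) // (ga j)] => //.
  - by apply: wedge_bX; lia.
  - by apply: h2; lia.
  - by apply: wedge_abX; lia.
  - by apply: wedge_aX; lia.
have k2 : 1 < 2 * k by lia.
have g_lt_p (i : nat) : i < 2 * k -> i != 1 -> Y (g i) < Y p.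
  move=> ik i1; have hb := Ybl k.-1.
  have [->|i2] : i = 0 \/ 1 < i by lia.
    by rewrite /g /=; lia.
  case: (boolP (odd i)) => oi; [rewrite gb //|rewrite ga //].
    by have := h4 (l + (i - 2)./2) (l + k.-1); lia.
  by have := @wedge_abY (l + (i - 2)./2) (l + k.-1); lia.
move=> t tE; right; apply: Wedge_type2; split.
- lia.
- move=> i; rewrite /pos /entry => -[i1].
  (* Otherwise the preimage [j] of the value just above [t i] would be a point higher than [p]. *)
  apply/eqP; rewrite eqn_leq ltn_ord /= leqNgt; apply/negP => ti.
  have lt : (t i).+1 < 2 * k by lia.
  pose j := (t^-1)%g (Ordinal lt).
  have : t i < t j by rewrite permKV /=.
  rewrite -tE i1 {1}/g /= => h.
  have := g_lt_p j (ltn_ord j).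
  have [j1|_ /(_ isT)] := eqVneq (j : nat) 1; last lia.
  by move: h; rewrite j1 /g /= ltnn.
- move=> i j /andP[/= oi ik] /andP[/= oj jk] ij.
  have := ltn_ord j; rewrite /pos in ik jk; rewrite -tE ga ?ga //; try lia.
  by move=> jl; apply: h3; lia.
- move=> i j /andP[/= oi ik] /andP[/= oj jk] ij.
  have := ltn_ord j; rewrite /pos in ik jk; rewrite -tE gb ?gb //; try lia.
  by move=> jl; apply: h4; lia.
move=> i; rewrite /pos => -[i0].
split=> [j /andP[/= oj jk]|j /andP[/= oj jk]]; have jl := ltn_ord j;
  rewrite /pos in jk; rewrite -tE i0.
  rewrite (ga j); try lia.
  rewrite /g /=; have := Yal (j - 2)./2; lia.
rewrite (gb j); try lia.
rewrite /g /=; have := Ybl (j - 2)./2; lia.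
Qed.

End Wedge.

(** Flipping exchanges the arms, but a wedge must begin on its lower arm; dropping [a 0] restores
    this at the cost of one level. *)
Lemma wedge_flip (T : finType) (X Y : T -> nat) m a b : 1 < m ->
  wedge X Y m a b -> wedge X (flip Y) m.-1 b (fun i => a i.+1).
Proof.
move=> m1 W; case: (W) => h1 h2 h3 h4 _; split=> [i im|i j ijm|i j ijm|i j ijm|].
- by apply: h2; lia.
- by apply: (wedge_abX W); lia.
- by rewrite ltn_flip; apply: h4; lia.
- by rewrite ltn_flip; apply: h3; lia.
by rewrite ltn_flip; apply: (wedge_abY W); lia.
Qed.

(** * Wedges in a point set with short pin sequences *)

(** The trace of the pin condition used inside wedges: in one coordinate [p] falls strictly within
    the span of [q]. It mentions only order, so it passes to all symmetric copies. *)
Definition cuts (T : eqType) (X Y : T -> nat) (q : seq T) (p : T) : bool :=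
  has (fun u => X u < X p) q && has (fun u => X p < X u) q ||
  has (fun u => Y u < Y p) q && has (fun u => Y p < Y u) q.

Definition cut_sequence (T : eqType) (X Y : T -> nat) (q : seq T) : Prop :=
  forall q1 p q2, q = q1 ++ p :: q2 -> 1 < size q1 -> cuts X Y q1 p.

Definition extremal (T : Type) (X Y : T -> nat) (z : T) : Prop :=
  [\/ forall u, X u <= X z, forall u, X z <= X u,
      forall u, Y u <= Y z | forall u, Y z <= Y u].

(** The form in which the absence of proper pin sequences of length [2 * k] is carried along; all
    four extremal directions are allowed so that it survives flips and swaps. *)
Definition short_reach (T : eqType) k (X Y : T -> nat) : Prop :=
  forall p1 p2 z, p1 != p2 -> extremal X Y z ->
  exists q, [/\ size (p1 :: p2 :: q) < 2 * k, z \in p1 :: p2 :: q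
              & cut_sequence X Y (p1 :: p2 :: q)].

Lemma short_reach_swap (T : eqType) k (X Y : T -> nat) :
  short_reach k X Y -> short_reach k Y X.
Proof.
move=> R p1 p2 z p12 ez; have [|q [h1 h2 h3]] := R p1 p2 z p12.
  by case: ez => ez; [apply: Or43|apply: Or44|apply: Or41|apply: Or42].
exists q; split=> // q1 p q2 e s1.
by rewrite /cuts orbC; apply: h3 e s1.
Qed.

Lemma short_reach_flipX (T : finType) k (X Y : T -> nat) :
  short_reach k X Y -> short_reach k (flip X) Y.
Proof.
move=> R p1 p2 z p12 ez; have [|q [h1 h2 h3]] := R p1 p2 z p12.
  case: ez => ez; [apply: Or42|apply: Or41|apply: Or43|apply: Or44] => // u;
    by rewrite -leq_flip.
exists q; split=> // q1 p q2 e s1.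
have := h3 _ _ _ e s1; rewrite /cuts andbC.
by rewrite -!(eq_has (fun u => ltn_flip X _ u)) -!(eq_has (fun u => ltn_flip X u _)).
Qed.

Lemma short_reach_flipY (T : finType) k (X Y : T -> nat) :
  short_reach k X Y -> short_reach k X (flip Y).
Proof. by move/short_reach_swap/short_reach_flipX/short_reach_swap. Qed.

(* A pin sequence starting at the tip of the wedge must eventually leave it.
   A pin that crosses [k] levels at once yields a wedge simple permutation, and
   fewer than [2 * k] pins crossing fewer than [k] levels each cannot leave. *)
Lemma wedge_target (T : finType) k (X Y : T -> nat) m a b : 1 < k ->
  injective X -> injective Y -> short_reach k X Y ->
  2 * k ^ 2 <= m -> wedge X Y m a b -> has_target k X Y.
Proof.
move=> k1 injX injY R; rewrite expnS expn1 => hm W; case: (W) => h1 h2 h3 h4 h5.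
have m1 : 1 < m by nia.
(* The points enclosed by level [l] of the wedge. The tip is enclosed by level 1, and the rightmost
   point [z] by no level. *)
pose inside l u := [&& Y (a l) < Y u, Y u < Y (b l) & X u < X (a l)].
have [z _ zmax] : exists2 z, true & forall u, X u <= X z.
  by case: (@arg_maxnP T (a 0) xpredT X isT) => z _ h; exists z => // u; apply: h.
have ab0 : a 0 != b 0 by apply: contraTneq h5 => ->; rewrite ltnn.
have [q [sq zq cq]] := R _ _ _ ab0 (Or41 _ _ _ zmax).
have mono l l' u : l <= l' < m -> inside l u -> inside l' u.
  move=> ll' /and3P[i1 i2 i3].
  case: (ltngtP l l') => ll; last by rewrite -ll; apply/and3P.
    have := h3 l l'; have := h4 l l'; have := wedge_aX W (i := l) (j := l').
    rewrite /inside; lia.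
  lia.
suff step r : cut_sequence X Y (a 0 :: b 0 :: r) -> 1 + size r * k < m ->
    has_target k X Y \/ {in a 0 :: b 0 :: r, forall u, inside (1 + size r * k) u}.
  have hq : 1 + size q * k < m by move: sq => /=; nia.
  case: (step q cq hq) => // /(_ z zq) /and3P[_ _].
  by rewrite ltnNge zmax.
elim/last_ind: r => [|r p IH] cr rm.
  right=> u; rewrite !inE mul0n addn0 => /orP[]/eqP->.
    by rewrite /inside h3 ?(wedge_abY W) ?(wedge_aX W) //; lia.
  by rewrite /inside h4 ?(wedge_abY W) ?h2 //; lia.
rewrite size_rcons mulSn in rm *.
case: IH => [q1 v q2 e|||IH].
- by apply: (cr q1 v (rcons q2 p)); rewrite -!rcons_cons e rcons_cat.
- lia.
- by left.
set l := 1 + size r * k in IH rm.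
have lE : 1 + (k + size r * k) = l + k by rewrite /l; lia.
rewrite lE in rm *.
have [pin|pout] := boolP (inside (l + k) p).
  right=> u; rewrite -!rcons_cons mem_rcons inE => /orP[/eqP->//|ur].
  by apply: mono (IH u ur); lia.
left.
(* If [p] cuts in [X], it stays left of level [l] and leaves through the top or bottom, giving type
   2; if it cuts in [Y], it stays between the heights of level [l] and leaves to the right, giving
   type 1. *)
have /orP[] : cuts X Y (a 0 :: b 0 :: r) p.
- by apply: (cr _ p [::]); rewrite // -!rcons_cons cats1.
- case/andP=> /hasP[u ur up] /hasP[v vr pv].
  have /and3P[u1 u2 u3] := IH u ur; have /and3P[v1 v2 v3] := IH v vr.
  have ap : X p < X (a (l + k)).
    by have := wedge_aX W (i := l) (j := l + k); lia.
  have [pb|pa] : Y (b (l + k)) <= Y p \/ Y p <= Y (a (l + k)).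
    by move: pout; rewrite /inside; lia.
    apply: (wedge_type2 injY W (l := l) (u := u) (p := p)) => //; try lia.
    by have := h4 (l + k.-1) (l + k); lia.
  apply: has_target_flipY.
  apply: (wedge_type2 (flip_inj injY) (wedge_flip m1 W) (l := l) (u := u) (p := p)) => //.
  + lia.
  + by have := h1 l; lia.
  + rewrite !ltn_flip; have := h3 l l.+1; lia.
  by rewrite leq_flip (_ : (l + k.-1).+1 = l + k) //; lia.
case/andP=> /hasP[u ur up] /hasP[v vr pv].
have /and3P[u1 u2 u3] := IH u ur; have /and3P[v1 v2 v3] := IH v vr.
have Yp : Y (a l) < Y p < Y (b l) by lia.
apply: (wedge_type1 injY W (l := l) (p := p)) => //.
have := h3 l (l + k); have := h4 l (l + k); move: pout; rewrite /inside; lia.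
Qed.

(** * Alternations *)

Lemma subseq_rcons_inv (U : eqType) (x : U) c l : subseq c (rcons l x) ->
  subseq c l \/ exists2 c', c = rcons c' x & subseq c' l.
Proof.
rewrite -cats1 => /subseqP[m]; rewrite size_cat addn1 => sm ->.
case/lastP: m sm => [|m b]; first by [].
rewrite size_rcons => -[sm].
rewrite -cats1 mask_cat //; case: b => /=.
  right; exists (mask m l); last exact: mask_subseq.
  by rewrite cats1.
by left; rewrite cats0; apply: mask_subseq.
Qed.

Section ErdosSzekeres.
Variables (U : eqType) (f : U -> nat).

(** Here [l1] collects the weak left-to-right minima and [l2] the rest. A non-minimum has a smaller
    element before it, so a subsequence of [l2] can be prolonged at the front; this drives the
    induction on [p] below. *)
Lemma left_to_right_minima (l : seq U) : exists l1 l2,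
  [/\ subseq l1 l, subseq l2 l, size l1 + size l2 = size l,
      pairwise (fun u v => f v <= f u) l1
    & forall v c, subseq (v :: c) l2 ->
        exists2 u, f u < f v & subseq (u :: v :: c) l].
Proof.
elim/last_ind: l => [|l x [l1 [l2 [s1 s2 s12 dec inc]]]].
  by exists [::], [::]; split.
have sx c : subseq c l -> subseq c (rcons l x).
  by move=> /subseq_trans; apply; apply: subseq_rcons.
have rx c : subseq c l -> subseq (rcons c x) (rcons l x).
  by move=> cl; rewrite -!cats1 cat_subseq.
have [/hasP[u ul ux]|/hasPn nx] := boolP (has (fun u => f u < f x) l).
  exists l1, (rcons l2 x); rewrite !size_rcons addnS s12; split; auto.
  move=> v c /subseq_rcons_inv[/inc[w wv sw]|[[|w c'] [-> ->] sc]].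
  - by exists w => //; apply: sx.
  - by exists u => //; apply: (rx [:: u]); rewrite sub1seq.
  have [y yw sy] := inc _ _ sc.
  by exists y => //; rewrite -!rcons_cons; apply: rx.
exists (rcons l1 x), l2; rewrite !size_rcons addSn s12; split; auto.
  rewrite pairwise_rcons dec andbT; apply/allP => u /(mem_subseq s1)/nx.
  by rewrite -leqNgt.
by move=> v c /inc[w wv sw]; exists w => //; apply: sx.
Qed.

Lemma erdos_szekeres_weak p q (l : seq U) : p * q < size l ->
  exists2 c, subseq c l &
    size c = p.+1 /\ pairwise (fun u v => f u < f v) c \/
    size c = q.+1 /\ pairwise (fun u v => f v <= f u) c.
Proof.
elim: p l => [|p IH] l.
  by case: l => [|x l] // _; exists [:: x]; [rewrite sub1seq mem_head|left].
have [l1 [l2 [s1 s2 s12 dec inc]]] := left_to_right_minima l.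
rewrite mulSn => lt; have [l1q|l1q] := ltnP q (size l1).
  exists (take q.+1 l1); first exact: subseq_trans (take_subseq _ _) s1.
  by right; rewrite size_takel // (subseq_pairwise (take_subseq _ _)).
have [|c cl2 [[sc pc]|h]] := IH l2; first lia.
  case: c cl2 sc pc => // v c /inc[u uv uc] sc pc.
  exists (u :: v :: c) => //; left; split; first by rewrite /= -sc.
  rewrite [pairwise _ _]/= uv -[X in _ && X]/(pairwise _ (v :: c)) pc andbT /=.
  move: pc => /= /andP[vc _]; apply: sub_all vc => w; exact: ltn_trans.
by exists c; [apply: subseq_trans s2|right].
Qed.

Lemma erdos_szekeres m (l : seq U) : uniq [seq f u | u <- l] ->
  m ^ 2 <= size l ->
  exists c, [/\ subseq c l, size c = m &
    pairwise (fun u v => f u < f v) c \/ pairwise (fun u v => f v < f u) c].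
Proof.
case: m => [|m] ul lm; first by exists [::]; split; [apply: sub0seq| |left].
have [|c cl h] := @erdos_szekeres_weak m m l.
  by move: lm; rewrite expnS expn1; nia.
exists c; case: h => -[sc pc]; split=> //; [by left|right].
have := subseq_uniq (map_subseq f cl) ul.
rewrite uniq_pairwise pairwise_map => uc.
have : pairwise [rel u v | (f u != f v) && (f v <= f u)] c.
  by rewrite (pairwise_relI (fun u v => f u != f v)) uc.
by apply: sub_pairwise => u v /=; lia.
Qed.

End ErdosSzekeres.

(** * Alternations and wedges from points on both sides of a line *)

Section ParallelAlternation.
Variables (T : finType) (X Y : T -> nat) (k : nat) (a b : nat -> T).
Hypotheses (injY : injective Y)
  (abX : forall i, i < k -> X (a i) < X (b i))
  (baX : forall i j, i < j < k -> X (b i) < X (a j))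
  (abY : forall i j, i < k -> j < k -> Y (a i) < Y (b j))
  (par : (forall i j, i < j < k -> Y (a i) < Y (a j) /\ Y (b i) < Y (b j)) \/
         (forall i j, i < j < k -> Y (a j) < Y (a i) /\ Y (b j) < Y (b i))).

Lemma parallel_target : has_target k X Y.
Proof.
pose g i := if odd i then b i./2 else a i./2.
have abX' i j : i <= j < k -> X (a i) < X (b j).
  move=> ijk; have := abX (i := j); case: (ltngtP i j) => ij; try lia.
    have := abX (i := i); have := @baX i j; lia.
  by rewrite ij; apply; lia.
apply: (has_target_standardization (f := fun i : 'I_(2 * k) => g i)) => //.
  move=> i j ij; have jk := ltn_ord j; rewrite /g.
  have aab u v : u < v < k -> X (a u) < X (a v).
    by move=> uv; have := @abX u; have := @baX u v; lia.
  have bb u v : u < v < k -> X (b u) < X (b v).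
    by move=> uv; have := @abX v; have := @baX u v; lia.
  case: (boolP (odd i)) => oi; case: (boolP (odd j)) => oj.
  - by apply: bb; lia.
  - by apply: baX; lia.
  - by apply: abX'; lia.
  - by apply: aab; lia.
move=> t tE; left; left; split.
  apply/vertical_alternationP; left=> i j; rewrite /pos /= negbK => oi oj.
  have := ltn_ord i; have := ltn_ord j; rewrite -tE /g oj (negbTE oi).
  by move=> jk ik; apply: abY; lia.
case: par => h; [left|right]; split=> i j; rewrite /pos inE /= ?negbK => oi oj ij;
  have := ltn_ord j; rewrite -tE /g; rewrite ?(negbTE oi) ?(negbTE oj) ?oi ?oj => jk;
  by case: (h i./2 j./2); lia.
Qed.

End ParallelAlternation.

Lemma pairwise_rev (U : Type) (r : U -> U -> bool) (s : seq U) :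
  pairwise r (rev s) = pairwise (fun u v => r v u) s.
Proof. by elim: s => //= u s IH; rewrite rev_cons pairwise_rcons all_rev IH. Qed.

Section Alternation.
Variables (T : finType) (k : nat).
Hypothesis k1 : 1 < k.
Implicit Types X Y : T -> nat.

(** The number of levels that [wedge_target] demands. *)
Let m := 2 * k ^ 2.

(** The first member of a pair is the lower one; which of them is on the left is left open, hence
    [minn] and [maxn]. *)
Definition straddling X Y x (ps : seq (T * T)) : Prop :=
  pairwise (fun p q => maxn (X p.1) (X p.2) < minn (X q.1) (X q.2)) ps /\
  {in ps, forall p, Y p.1 < Y x < Y p.2}.

(** Erdős-Szekeres is applied to the lower points, then to the upper ones, which accounts for the
    two squares. Equal directions give a parallel alternation, opposite ones a wedge. *)
Lemma straddling_target_aux X Y x ps : injective X -> injective Y ->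
  short_reach k X Y -> straddling X Y x ps -> (m ^ 2) ^ 2 <= size ps ->
  {in ps, forall p, X p.1 < X p.2} -> has_target k X Y.
Proof.
move=> injX injY R [sX sY] sz lX.
have sX1 : pairwise (fun p q => X p.1 < X q.1) ps.
  by apply: sub_pairwise sX => p q; lia.
have sX2 : pairwise (fun p q => X p.2 < X q.2) ps.
  by apply: sub_pairwise sX => p q; lia.
have uniqY (f : T * T -> T) qs : pairwise (fun p q => X (f p) < X (f q)) qs ->
    uniq [seq Y (f p) | p <- qs].
  move=> h; rewrite map_comp map_inj_uniq // -(map_inj_uniq injX) -map_comp.
  rewrite uniq_pairwise pairwise_map; apply: sub_pairwise h => p q /=; lia.
have [qs [qps sq mon1]] := erdos_szekeres (uniqY fst ps sX1) sz.
have [|rs [rqs sr mon2]] := @erdos_szekeres _ _ m _ (uniqY snd qs (subseq_pairwise qps sX2)).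
  by rewrite sq.
have {}mon1 : pairwise (fun p q => Y p.1 < Y q.1) rs \/
    pairwise (fun p q => Y q.1 < Y p.1) rs.
  by case: mon1 => h; [left|right]; apply: subseq_pairwise h.
have rps := subseq_trans rqs qps.
have {}sX := subseq_pairwise rps sX.
have {}sY : {in rs, forall p, Y p.1 < Y x < Y p.2}.
  by move=> p /(mem_subseq rps)/sY.
have {}lX : {in rs, forall p, X p.1 < X p.2} by move=> p /(mem_subseq rps)/lX.
clear ps qs sX1 sX2 uniqY sz qps sq rqs rps.
have km : k < m by rewrite /m expnS expn1; nia.
pose a i := (nth (x, x) rs i).1; pose b i := (nth (x, x) rs i).2.
have ab i : i < m -> X (a i) < X (b i).
  by move=> im; apply: lX; rewrite mem_nth ?sr.
have nthm (r : rel (T * T)) : pairwise r rs ->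
    forall i j, i < j < m -> r (nth (x, x) rs i) (nth (x, x) rs j).
  by move=> /(pairwiseP (x, x)) h i j ijm; apply: h; rewrite ?inE ?sr; lia.
have ba i j : i < j < m -> X (b i) < X (a j).
  by move/(nthm _ sX) => /=; rewrite /a /b; lia.
have Yab i j : i < m -> j < m -> Y (a i) < Y (b j).
  have h u : u < m -> Y (a u) < Y x < Y (b u).
    by move=> um; apply: sY; rewrite mem_nth ?sr.
  by move=> /h + /h; lia.
have parallel : (forall i j, i < j < m -> Y (a i) < Y (a j) /\ Y (b i) < Y (b j)) \/
    (forall i j, i < j < m -> Y (a j) < Y (a i) /\ Y (b j) < Y (b i)) ->
    has_target k X Y.
  move=> h; apply: (parallel_target (a := a) (b := b) injY).
  - by move=> i ik; apply: ab; lia.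
  - by move=> i j ijk; apply: ba; lia.
  - by move=> i j ik jk; apply: Yab; lia.
  - by case: h => h; [left|right] => i j ijk; apply: h; lia.
case: mon1 mon2 => /nthm m1 [] /nthm m2.
- by apply: parallel; left=> i j ij; split; [apply: m1|apply: m2].
(* Lower points rise and upper points fall: the wedge opens to the left, and a half turn makes it
   open to the right. *)
- pose a' i := b (m.-1 - i); pose b' i := a (m.-1 - i).
  apply/has_target_flipX/has_target_flipY.
  apply: (wedge_target (m := m) (a := a') (b := b')) => //.
  + exact: flip_inj.
  + exact: flip_inj.
  + exact/short_reach_flipY/short_reach_flipX.
  split=> [i im|i j ijm|i j ijm|i j ijm|]; rewrite ltn_flip /a' /b'.
  + by apply: ab; lia.
  + by apply: ba; lia.
  + by apply: m2; lia.
  + by apply: m1; lia.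
  + by apply: Yab; lia.
- apply: (wedge_target (m := m) (a := a) (b := b)) => //; split=> //.
  by apply: Yab; lia.
- by apply: parallel; right=> i j ij; split; [apply: m1|apply: m2].
Qed.

Lemma straddling_target X Y x ps : injective X -> injective Y ->
  short_reach k X Y -> straddling X Y x ps -> (m ^ 2) ^ 2 <= size ps ->
  {in ps, forall p, X p.1 < X p.2} \/ {in ps, forall p, X p.2 < X p.1} ->
  has_target k X Y.
Proof.
move=> injX injY R [sX sY] sz [lX|lX].
  exact: (@straddling_target_aux X Y x ps).
apply: has_target_flipY.
pose swap (p : T * T) := (p.2, p.1).
apply: (@straddling_target_aux _ _ x [seq swap p | p <- ps]) => //.
- exact: flip_inj.
- exact: short_reach_flipY.
- split.
    by rewrite pairwise_map; apply: sub_pairwise sX => p q /=; rewrite maxnC minnC.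
  by move=> _ /mapP[p /sY h ->] /=; rewrite !ltn_flip andbC.
- by rewrite size_map.
by move=> _ /mapP[p /lX h ->].
Qed.

Lemma sorted_enum Z (S : {set T}) : injective Z -> exists l : seq T,
  [/\ size l = #|S|, l =i S & pairwise (fun u v => Z u < Z v) l].
Proof.
move=> injZ; pose l := sort (relpre Z leq) (enum S); exists l; split.
- by rewrite size_sort cardE.
- by move=> u; rewrite mem_sort mem_enum.
have ul : uniq (map Z l) by rewrite map_inj_uniq // sort_uniq enum_uniq.
have sl : sorted leq (map Z l).
  by rewrite sorted_map; apply: sort_sorted => u v /=; exact: leq_total.
have : sorted ltn (map Z l) by rewrite ltn_sorted_uniq_leq ul.
by rewrite (sorted_pairwise ltn_trans) pairwise_map.
Qed.

(** Serves the case where [x] follows immediately after a starting pair [g y], [y]: the pair itself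
    straddles the height of [x]. *)
Lemma successor_pairs_target X Y x (g : T -> T) (S : {set T}) :
  injective X -> injective Y -> short_reach k X Y ->
  {in S, forall y, X (g y) < X y} ->
  {in S &, forall y z, X y < X z -> X y < X (g z)} ->
  {in S, forall y, Y (g y) < Y x < Y y} \/ {in S, forall y, Y y < Y x < Y (g y)} ->
  (m ^ 2) ^ 2 <= #|S| -> has_target k X Y.
Proof.
move=> injX injY R gX gX2 hY sz.
have [l [sl lS pl]] := sorted_enum S injX.
have inS y : y \in l -> y \in S by rewrite lS.
have plS : pairwise (fun y z => maxn (X (g y)) (X y) < minn (X (g z)) (X z)) l.
  apply: (sub_in_pairwise (P := mem l)) pl; last by apply/allP.
  move=> y z /inS yl /inS zl yz.
  by have := gX _ yl; have := gX _ zl; have := gX2 _ _ yl zl yz; lia.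
case: hY => hY.
  apply: (@straddling_target X Y x [seq (g y, y) | y <- l]) => //.
  + split; first by rewrite pairwise_map.
    by move=> _ /mapP[y /inS/hY h ->].
  + by rewrite size_map sl.
  + by left=> _ /mapP[y /inS/gX h ->].
apply: (@straddling_target X Y x [seq (y, g y) | y <- l]) => //.
- split; last by move=> _ /mapP[y /inS/hY h ->].
  by rewrite pairwise_map; apply: sub_pairwise plS => y z /=; rewrite maxnC minnC.
- by rewrite size_map sl.
by right=> _ /mapP[y /inS/gX h ->].
Qed.

(* [x] is to the right of a rectangle with bottom point [a] and top point [b],
   and [y] is a maximal right pin of that rectangle beyond [x]. *)
Definition pinned X Y x y : Prop := exists a b,
  [/\ X a < X x, X b < X x, X x < X y, Y a < Y y < Y b
    & forall w, X x < X w -> Y a < Y w < Y b -> X w <= X y].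

Lemma pinned_flipY X Y x y : pinned X Y x y -> pinned X (flip Y) x y.
Proof.
case=> a [b [h1 h2 h3 h4 h5]]; exists b, a; split=> //; first by rewrite !ltn_flip andbC.
by move=> w xw; rewrite !ltn_flip andbC; apply: h5.
Qed.

(* By maximality the top of each rectangle lies below the next pin. *)
Lemma pinned_increasing_target X Y x l : injective X -> injective Y ->
  short_reach k X Y -> {in l, forall y, pinned X Y x y} ->
  pairwise (fun y z => (Y y < Y z) && (X y < X z)) l ->
  (m ^ 2) ^ 2 <= size l -> has_target k X Y.
Proof.
(* Tops lie to the left of [x] and pins to the right, so the alternation is read with the
   coordinates exchanged. *)
move=> injX injY R hl pl sz; apply: has_target_swap.
have /fin_all_exists[b hb] y : exists b : T, y \in l ->
    [/\ X b < X x < X y, Y y < Y b & forall w, X y < X w -> Y y < Y w -> Y b < Y w].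
  case: (boolP (y \in l)) => [yl|_]; last by exists y.
  have [a [b [h1 h2 h3 /andP[h4 h5] h6]]] := hl y yl.
  exists b => _; split=> [||w yw Yw]; rewrite ?h2 //.
  have xw := ltn_trans h3 yw.
  case: (ltngtP (Y w) (Y b)) => // [wb|/injY e].
    by have := h6 w xw; rewrite wb (ltn_trans h4 Yw) leqNgt yw => /(_ isT).
  by move: h2; rewrite -e; lia.
apply: (@straddling_target Y X x [seq (b y, y) | y <- l]) => //.
- exact: short_reach_swap.
- split; last by move=> _ /mapP[y /hb[h _ _] ->].
  rewrite pairwise_map.
  apply: (sub_in_pairwise (P := mem l)) pl; last by apply/allP.
  move=> y z /hb[_ h1 h2] /hb[_ h3 _] /andP[Yyz Xyz] /=.
  by have := h2 z Xyz Yyz; lia.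
- by rewrite size_map.
by right=> _ /mapP[y /hb[_ h _] ->].
Qed.

(** A third use of Erdős-Szekeres makes the pins monotone. If they decrease, flipping [Y] makes them
    increase, and bottoms take over the role of tops. *)
Lemma pinned_target X Y x (S : {set T}) : injective X -> injective Y ->
  short_reach k X Y -> {in S, forall y, pinned X Y x y} ->
  ((m ^ 2) ^ 2) ^ 2 <= #|S| -> has_target k X Y.
Proof.
move=> injX injY R hS sz.
have [l [sl lS pl]] := sorted_enum S injY.
have ul : uniq [seq X y | y <- l].
  rewrite map_inj_uniq // -(map_inj_uniq injY) uniq_pairwise pairwise_map.
  by apply: sub_pairwise pl => y z /=; lia.
have [|c [cl sc mon]] := @erdos_szekeres _ X ((m ^ 2) ^ 2) l ul; first by rewrite sl.
have cS y : y \in c -> y \in S by move/(mem_subseq cl); rewrite lS.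
have pc := subseq_pairwise cl pl.
case: mon => mon.
  apply: (@pinned_increasing_target X Y x c) => //; last by rewrite sc.
    by move=> y /cS/hS.
  by rewrite (pairwise_relI (fun y z => Y y < Y z)) pc.
apply: has_target_flipY.
apply: (@pinned_increasing_target X (flip Y) x (rev c)) => //.
- exact: flip_inj.
- exact: short_reach_flipY.
- by move=> y; rewrite mem_rev => /cS/hS/pinned_flipY.
- rewrite pairwise_rev.
  have : pairwise [rel y z | (Y y < Y z) && (X z < X y)] c.
    by rewrite (pairwise_relI (fun y z => Y y < Y z)) pc.
  by apply: sub_pairwise => y z /=; rewrite ltn_flip.
by rewrite size_rev sc.
Qed.

End Alternation.

(** * Proper pin sequences *)

Lemma leq_bigmin (U : Type) (F : U -> nat) x0 c (q : seq U) :
  (c <= \big[minn/x0]_(r <- q) F r) = (c <= x0) && all (fun r => c <= F r) q.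
Proof.
elim: q => [|u q IH]; first by rewrite big_nil andbT.
by rewrite big_cons leq_min IH /= andbCA.
Qed.

Lemma geq_bigmax (U : Type) (F : U -> nat) c (q : seq U) :
  (\max_(r <- q) F r <= c) = all (fun r => F r <= c) q.
Proof.
elim: q => [|u q IH]; first by rewrite big_nil.
by rewrite big_cons geq_max IH.
Qed.

Section Hull.
Variables (n : nat) (s : 'S_n).
Implicit Types (q : seq 'I_n).

Definition pt i : point := (pos i, entry s i).

Lemma pos_inj : injective (@pos n).
Proof. by move=> i j [] /val_inj. Qed.

Lemma entry_inj : injective (entry s).
Proof. by move=> i j [] /val_inj /perm_inj. Qed.

Lemma pt_inj : injective pt.
Proof. by move=> i j [] /val_inj. Qed.

Lemma mem_plot i : pt i \in plot s.
Proof. exact: codom_f. Qed.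

Definition hull q : rectangle := rect [seq pt i | i <- q].

Lemma leq_xmin q c : q != [::] -> (c <= xmin (hull q)) = all (fun i => c <= pos i) q.
Proof.
case: q => // i q _; rewrite leq_bigmin all_map /= andbA andbb.
by [].
Qed.

Lemma leq_ymin q c : q != [::] -> (c <= ymin (hull q)) = all (fun i => c <= entry s i) q.
Proof.
by case: q => // i q _; rewrite leq_bigmin all_map /= andbA andbb.
Qed.

Lemma geq_xmax q c : (xmax (hull q) <= c) = all (fun i => pos i <= c) q.
Proof. by rewrite geq_bigmax all_map. Qed.

Lemma geq_ymax q c : (ymax (hull q) <= c) = all (fun i => entry s i <= c) q.
Proof. by rewrite geq_bigmax all_map. Qed.

Lemma hullE q : hull q = rect [seq pt i | i <- q].
Proof. by []. Qed.

End Hull.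

(* Otherwise simplification would expand the projections of [hull s q]. *)
Opaque hull.

(** * Extreme pins of a rectangle and their existence *)

Section Pins.
Variables (n : nat) (s : 'S_n).
Implicit Types (i j z : 'I_n) (q r : seq 'I_n).

Local Notation pt := (pt s).
Local Notation hull := (hull s).

Lemma mem_hull q i : i \in q ->
  xmin (hull q) <= pos i <= xmax (hull q) /\
  ymin (hull q) <= entry s i <= ymax (hull q).
Proof.
move=> iq; have q0 : q != [::] by case: q iq.
have := leqnn (xmin (hull q)); have := leqnn (ymin (hull q)).
have := leqnn (xmax (hull q)); have := leqnn (ymax (hull q)).
rewrite {1}leq_xmin // {1}leq_ymin // {1}geq_xmax {1}geq_ymax.
by move=> /allP/(_ i iq) h1 /allP/(_ i iq) h2 /allP/(_ i iq) h3 /allP/(_ i iq) h4; lia.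
Qed.

Lemma hull_attained q : q != [::] ->
  [/\ exists2 i, i \in q & pos i = xmin (hull q),
      exists2 i, i \in q & pos i = xmax (hull q),
      exists2 i, i \in q & entry s i = ymin (hull q)
    & exists2 i, i \in q & entry s i = ymax (hull q)].
Proof.
move=> q0; split.
- have : ~~ ((xmin (hull q)).+1 <= xmin (hull q)) by rewrite ltnn.
  rewrite leq_xmin // -has_predC => /hasP[i iq /= h]; exists i => //.
  by have := mem_hull iq; lia.
- have q1 : 0 < xmax (hull q).
    case: q q0 => // i q _; have /mem_hull : i \in i :: q by exact: mem_head.
    move=> h; have : 0 < pos i by []; lia.
  have : ~~ (xmax (hull q) <= (xmax (hull q)).-1) by lia.
  rewrite geq_xmax // -has_predC => /hasP[i iq /= h]; exists i => //.
  by have := mem_hull iq; lia.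
- have : ~~ ((ymin (hull q)).+1 <= ymin (hull q)) by rewrite ltnn.
  rewrite leq_ymin // -has_predC => /hasP[i iq /= h]; exists i => //.
  by have := mem_hull iq; lia.
have q1 : 0 < ymax (hull q).
  case: q q0 => // i q _; have /mem_hull : i \in i :: q by exact: mem_head.
    move=> h; have : 0 < entry s i by []; lia.
have : ~~ (ymax (hull q) <= (ymax (hull q)).-1) by lia.
rewrite geq_ymax // -has_predC => /hasP[i iq /= h]; exists i => //.
by have := mem_hull iq; lia.
Qed.

Lemma hull_sub r q : r != [::] -> {subset r <= q} ->
  xmin (hull q) <= xmin (hull r) /\ xmax (hull r) <= xmax (hull q) /\
  ymin (hull q) <= ymin (hull r) /\ ymax (hull r) <= ymax (hull q).
Proof.
move=> r0 rq; case: (hull_attained r0) => -[i1 h1 e1] [i2 h2 e2] [i3 h3 e3] [i4 h4 e4].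
have := mem_hull (rq _ h1); have := mem_hull (rq _ h2).
have := mem_hull (rq _ h3); have := mem_hull (rq _ h4); lia.
Qed.

Lemma hull_rcons q i : q != [::] ->
  [/\ xmin (hull (rcons q i)) = minn (xmin (hull q)) (pos i),
      xmax (hull (rcons q i)) = maxn (xmax (hull q)) (pos i),
      ymin (hull (rcons q i)) = minn (ymin (hull q)) (entry s i)
    & ymax (hull (rcons q i)) = maxn (ymax (hull q)) (entry s i)].
Proof.
move=> q0; have qi0 : rcons q i != [::] by case: q {q0}.
have sub : {subset q <= rcons q i} by move=> j; rewrite mem_rcons inE orbC => ->.
have mi : i \in rcons q i by rewrite mem_rcons mem_head.
have := hull_sub q0 sub; have := mem_hull mi.
case: (hull_attained qi0) => -[i1 h1 e1] [i2 h2 e2] [i3 h3 e3] [i4 h4 e4].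
have H j : j \in rcons q i -> j = i \/
    xmin (hull q) <= pos j <= xmax (hull q) /\
    ymin (hull q) <= entry s j <= ymax (hull q).
  by rewrite mem_rcons inE => /orP[/eqP|/mem_hull]; [left|right].
case: (H _ h1) => [?|H1]; case: (H _ h2) => [?|H2];
  case: (H _ h3) => [?|H3]; case: (H _ h4) => [?|H4]; subst; split; lia.
Qed.

Lemma hull_ordered q : q != [::] ->
  xmin (hull q) <= xmax (hull q) /\ ymin (hull q) <= ymax (hull q).
Proof. case: q => // i q _; have /mem_hull : i \in i :: q by exact: mem_head.
    move=> h; lia. Qed.

Lemma is_pin_cuts q i : q != [::] -> is_pin (hull q) (pt i) ->
  cuts (@pos n) (entry s) q i.
Proof.
move=> q0; case: (hull_attained q0) => -[i1 h1 e1] [i2 h2 e2] [i3 h3 e3] [i4 h4 e4].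
case/andP=> _ /orP[]/andP[/= lt1 lt2]; apply/orP; [left|right]; apply/andP; split;
  apply/hasP; [exists i1|exists i2|exists i3|exists i4] => //; lia.
Qed.

Lemma pin_notin q i : is_pin (hull q) (pt i) -> i \notin q.
Proof.
apply: contraL => /mem_hull h; rewrite /is_pin /in_rect /=; lia.
Qed.

Lemma hull_distinct q i : q != [::] -> i \notin q ->
  [/\ pos i != xmin (hull q), pos i != xmax (hull q),
      entry s i != ymin (hull q) & entry s i != ymax (hull q)].
Proof.
move=> q0 iq.
case: (hull_attained q0) => -[i1 h1 e1] [i2 h2 e2] [i3 h3 e3] [i4 h4 e4].
split; apply: contraNneq iq; rewrite -?e1 -?e2 -?e3 -?e4.
- by move/pos_inj->.
- by move/pos_inj->.
- by move/entry_inj->.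
- by move/entry_inj->.
Qed.

Definition best_pin q i : Prop :=
  is_pin (hull q) (pt i) /\
  forall d, is_pin_of d (hull q) (pt i) ->
    forall j, is_pin_of d (hull q) (pt j) -> ~~ further d (pt j) (pt i).

(** A competitor beyond [i] for the smaller rectangle lies outside the larger one too, and would
    compete with [i] there. *)
Lemma best_pin_sub r q i : r != [::] -> {subset r <= q} -> best_pin q i ->
  is_pin (hull r) (pt i) -> best_pin r i.
Proof.
move=> r0 rq [pin best] pin_r; split=> // d ri j rj; apply/negP => far.
have hs := hull_sub r0 rq; have ho := hull_ordered r0.
have qi : is_pin_of d (hull q) (pt i).
  by move: pin ri; rewrite /is_pin_of /is_pin /in_rect; case: d {rj far} => /=; lia.
have qj : is_pin_of d (hull q) (pt j).
  move: pin ri rj far; rewrite /is_pin_of /is_pin /in_rect; case: d {qi} => /=; lia.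
by have := best d qi j qj; rewrite far.
Qed.

Lemma is_pin_of_uniq q i d d' : q != [::] ->
  is_pin_of d (hull q) (pt i) -> is_pin_of d' (hull q) (pt i) -> d = d'.
Proof.
move=> /hull_ordered ho; rewrite /is_pin_of /is_pin /in_rect.
by case: d; case: d' => //=; lia.
Qed.

Lemma best_pin_exists q i : q != [::] -> is_pin (hull q) (pt i) ->
  exists j, best_pin q j.
Proof.
move=> q0 pin.
have [d di] : exists d, is_pin_of d (hull q) (pt i).
  have := hull_ordered q0; move: pin; rewrite /is_pin_of /is_pin /in_rect /= => h ho.
  have [|[|[|]]] : pos i < xmin (hull q) \/ xmax (hull q) < pos i \/
    entry s i < ymin (hull q) \/ ymax (hull q) < entry s i by lia.
  - by exists Left => /=; lia.
  - by exists Right => /=; lia.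
  - by exists Down => /=; lia.
  - by exists Up => /=; lia.
pose key j := match d with Left => n - pos j | Right => pos j
                         | Up => entry s j | Down => n - entry s j end.
have lepos j : pos j <= n by exact: ltn_ord.
have leentry j : entry s j <= n by exact: ltn_ord.
case: (@arg_maxnP _ i (fun j => is_pin_of d (hull q) (pt j)) key di) => j dj best.
exists j; split; first by case/andP: dj.
move=> d' d'j; rewrite -(is_pin_of_uniq q0 dj d'j) => l /best.
rewrite /key; have := lepos l; have := lepos j; have := leentry l; have := leentry j.
by case: d {di dj best key d'j} => /=; lia.
Qed.

Definition extreme_point z := extremal (@pos n) (entry s) z.

(** Without a pin, the columns and the rows of the rectangle contain the same points, which thus
    form an interval. By simplicity it is everything, and then the extremal point [z] lies on a side
    of the rectangle and so belongs to [q]. *)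
Lemma pin_exists q z p1 p2 : simple_perm s -> p1 != p2 -> p1 \in q -> p2 \in q ->
  extreme_point z -> z \notin q -> exists i, is_pin (hull q) (pt i).
Proof.
move=> simp p12 q1 q2 ext zq; apply: NNPP => no_pin.
have q0 : q != [::] by apply: contraTneq q1 => ->.
have np i : ~~ is_pin (hull q) (pt i) by apply/negP => h; apply: no_pin; exists i.
case: (hull_attained q0) => -[i1 h1 e1] [i2 h2 e2] [i3 h3 e3] [i4 h4 e4].
have E i : (xmin (hull q) <= pos i <= xmax (hull q)) =
    (ymin (hull q) <= entry s i <= ymax (hull q)).
  have [/mem_hull[-> ->] //|iq] := boolP (i \in q).
  case: (hull_distinct q0 iq) => d1 d2 d3 d4.
  by have := np i; rewrite /is_pin /in_rect /=; lia.
pose I := [set i : 'I_n | xmin (hull q) <= pos i <= xmax (hull q)].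
have qI i : i \in q -> i \in I by rewrite inE => /mem_hull[].
have : interval s I.
  split.
    (* Coordinates start at 1, indices at 0, and [consecutive] uses half-open ranges. *)
    exists (xmin (hull q)).-1, (xmax (hull q)); apply/setP => i; rewrite !inE /pos.
    by have : 0 < pos i1 by []; rewrite e1; lia.
  exists (ymin (hull q)).-1, (ymax (hull q)); apply/setP => v; rewrite !inE.
  rewrite -{1}(permKV s v) mem_imset ?inE ?E /entry ?permKV; last exact: perm_inj.
  by have : 0 < entry s i3 by []; rewrite e3; lia.
move/simp => card.
have c2 : 1 < #|I|.
  by apply/card_gt1P; exists p1, p2; rewrite !qI.
have IT : I = [set: 'I_n].
  apply/eqP; rewrite eqEcard subsetT cardsT card_ord /=.
  by case: card c2 => ->.
have zI : z \in I by rewrite IT inE.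
case: (hull_distinct q0 zq) => d1 d2 d3 d4.
have := E z; move: zI; rewrite inE => zx; rewrite zx => /esym zy.
by case: ext => ext; [have := ext i2|have := ext i1|have := ext i4|have := ext i3]; lia.
Qed.

End Pins.

Section Separation.
Variables (n : nat) (s : 'S_n).
Implicit Types (x y : 'I_n) (q r : seq 'I_n).

(** If [x] becomes a pin only once [y] is added, it must cut the part of the range that [y]
    contributes. *)
Lemma pin_separates q y x : q != [::] -> is_pin (hull s (rcons q y)) (pt s x) ->
  ~~ is_pin (hull s q) (pt s x) -> separates (pt s x) (hull s q) (pt s y).
Proof.
move=> q0 pin npin.
have := hull_ordered s q0.
have [xq1 xq] : x != y /\ x \notin q.
  by have := pin_notin pin; rewrite mem_rcons inE negb_or => /andP.
case: (hull_distinct s q0 xq) => d1 d2 d3 d4.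
case: (hull_rcons s y q0) => e1 e2 e3 e4.
have d5 : pos x != pos y by apply: contraNneq xq1 => /pos_inj ->.
have d6 : entry s x != entry s y by apply: contraNneq xq1 => /entry_inj ->.
move: pin npin; rewrite /is_pin /in_rect /separates /= e1 e2 e3 e4.
lia.
Qed.

Lemma separates_sub r q y x : r != [::] -> {subset r <= q} ->
  separates (pt s x) (hull s q) (pt s y) -> separates (pt s x) (hull s r) (pt s y).
Proof.
by move=> r0 rq; have := hull_sub s r0 rq; rewrite /separates /=; lia.
Qed.

Lemma separates_pin q y x : q != [::] -> ~~ in_rect (hull s (rcons q y)) (pt s x) ->
  separates (pt s x) (hull s q) (pt s y) -> is_pin (hull s (rcons q y)) (pt s x).
Proof.
move=> q0; have := hull_ordered s q0; case: (hull_rcons s y q0) => e1 e2 e3 e4.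
rewrite /is_pin /in_rect /separates /= e1 e2 e3 e4; lia.
Qed.

(** The four cases are the direction of [y]; the witnesses are the points of [q] on the two sides of
    the rectangle parallel to that direction. *)
Lemma best_pin_pinned q y x : q != [::] -> best_pin s q y ->
  separates (pt s x) (hull s q) (pt s y) ->
  [\/ pinned (@pos n) (entry s) x y, pinned (flip (@pos n)) (entry s) x y,
      pinned (entry s) (@pos n) x y | pinned (flip (entry s)) (@pos n) x y].
Proof.
move=> q0 [pin best].
case: (hull_attained s q0) => -[i1 h1 e1] [i2 h2 e2] [i3 h3 e3] [i4 h4 e4].
have ho := hull_ordered s q0.
have bound i : i \in q -> xmin (hull s q) <= pos i <= xmax (hull s q) /\
  ymin (hull s q) <= entry s i <= ymax (hull s q) := @mem_hull n s q i.
have H1 := bound _ h1; have H2 := bound _ h2.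
have H3 := bound _ h3; have H4 := bound _ h4.
rewrite /separates /= => /or4P[]/andP[lt1 lt2].
- apply: Or41; exists i3, i4; split; try lia.
    by move: pin; rewrite /is_pin /in_rect /=; lia.
  move=> w xw yw.
  have := best Right _ w; rewrite /is_pin_of /= -leqNgt; apply.
    by rewrite pin; lia.
  by rewrite /is_pin /in_rect /=; lia.
- apply: Or42; exists i3, i4; rewrite !ltn_flip; split; try lia.
    by move: pin; rewrite /is_pin /in_rect /=; lia.
  move=> w; rewrite ltn_flip leq_flip => xw yw.
  have := best Left _ w; rewrite /is_pin_of /= -leqNgt; apply.
    by rewrite pin; lia.
  by rewrite /is_pin /in_rect /=; lia.
- apply: Or43; exists i1, i2; split; try lia.
    by move: pin; rewrite /is_pin /in_rect /=; lia.
  move=> w xw yw.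
  have := best Up _ w; rewrite /is_pin_of /= -leqNgt; apply.
    by rewrite pin; lia.
  by rewrite /is_pin /in_rect /=; lia.
apply: Or44; exists i1, i2; rewrite !ltn_flip; split; try lia.
  by move: pin; rewrite /is_pin /in_rect /=; lia.
move=> w; rewrite ltn_flip leq_flip => xw yw.
have := best Down _ w; rewrite /is_pin_of /= -leqNgt; apply.
  by rewrite pin; lia.
by rewrite /is_pin /in_rect /=; lia.
Qed.

End Separation.

(** * From maximal pins to proper pin sequences *)

Section PinSequences.
Variables (n : nat) (s : 'S_n) (p1 p2 : 'I_n).
Hypothesis p12 : p1 != p2.
Implicit Types (i j x y z : 'I_n) (q r : seq 'I_n).

(** Maximality is imposed here, separation is not; [greedy_proper] recovers it by pruning. *)
Inductive greedy : seq 'I_n -> Prop :=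
  | Greedy_start : greedy [:: p1; p2]
  | Greedy_step q i : greedy q -> best_pin s q i -> greedy (rcons q i).

(* [proper_pins q i] means that [rcons q i] is a proper pin sequence; the last pin is
   kept apart because the separation condition treats it differently. *)
Inductive proper_pins : seq 'I_n -> 'I_n -> Prop :=
  | Proper_pins_start : proper_pins [:: p1] p2
  | Proper_pins_step q i x : proper_pins q i -> best_pin s (rcons q i) x ->
      separates (pt s x) (hull s q) (pt s i) -> proper_pins (rcons q i) x.

Lemma greedy_uniq q : greedy q -> uniq q.
Proof.
elim=> [|{}q i _ uq [/pin_notin iq _]]; first by rewrite /= inE p12.
by rewrite rcons_uniq iq.
Qed.

Lemma greedy_start q : greedy q -> p1 \in q /\ p2 \in q.
Proof.
elim=> [|{}q i _ [h1 h2] _]; first by rewrite !inE !eqxx orbT.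
by rewrite !mem_rcons !inE h1 h2 !orbT.
Qed.

(** While [z] is missing, a best pin exists and can be appended; pins never repeat, so this stops
    within [n] points, and [m] counts the remaining room. *)
Lemma greedy_reaches z : simple_perm s -> extreme_point s z ->
  z != p1 -> z != p2 -> exists2 q, greedy q & best_pin s q z.
Proof.
move=> simp ext z1 z2.
suff grow m q : greedy q -> z \notin q -> n <= size q + m ->
    exists2 q, greedy q & best_pin s q z.
  by apply: (grow n [:: p1; p2] Greedy_start); rewrite ?leq_addl // !inE negb_or z1.
elim: m q => [|m IH] q gq zq sq.
  have : size (z :: q) <= n.
    have /card_uniqP <- : uniq (z :: q) by rewrite /= zq greedy_uniq.
    by rewrite -[n in _ <= n]card_ord max_card.
  by rewrite /=; lia.
have [q1 q2] := greedy_start gq.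
have q0 : q != [::] by apply: contraTneq q1 => ->.
have [i /(best_pin_exists q0)[j bj]] := pin_exists simp p12 q1 q2 ext zq.
have [jz|jz] := eqVneq j z; first by exists q; rewrite // -jz.
apply: (IH (rcons q j)); first exact: Greedy_step.
  by rewrite mem_rcons inE negb_or eq_sym jz.
by rewrite size_rcons; lia.
Qed.

Lemma proper_neq0 q i : proper_pins q i -> q != [::].
Proof. by case=> // {}q j x _ _ _; case: q. Qed.

(** If [x] is still a pin without the last point [y], drop [y]. Otherwise [x] separates [y] from the
    rectangle: keep [y], prune what precedes it, and separation persists for the smaller rectangle,
    so [x] remains a pin. *)
Lemma greedy_proper q x : greedy q -> best_pin s q x ->
  exists2 r, proper_pins r x & {subset r <= q}.
Proof.
move=> gq; elim: gq x => [|{}q y gq IH by_] x bx.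
  exists [:: p1; p2] => //; apply: (@Proper_pins_step [:: p1] p2 x) => //.
    exact: Proper_pins_start.
  apply: pin_separates => //; first by case: bx.
  (* The rectangle of a single point is degenerate and has no pins. *)
  rewrite /is_pin; case: (@hull_attained n s [:: p1]) => //.
  move=> [i1 + <-] [i2 + <-] [i3 + <-] [i4 + <-].
  by rewrite !inE => /eqP-> /eqP-> /eqP-> /eqP->; lia.
have q0 : q != [::] by have [h _] := greedy_start gq; apply: contraTneq h => ->.
have sub : {subset q <= rcons q y} by move=> j; rewrite mem_rcons inE orbC => ->.
have [pin|npin] := boolP (is_pin (hull s q) (pt s x)).
  have [r pr rq] := IH x (best_pin_sub q0 sub bx pin).
  by exists r => // j /rq/sub.
have [r pr rq] := IH y by_.
have r0 := proper_neq0 pr.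
have sep := separates_sub r0 rq (pin_separates q0 bx.1 npin).
have rqy : {subset rcons r y <= rcons q y}.
  by move=> j; rewrite !mem_rcons !inE => /orP[->|/rq->]; rewrite ?orbT.
have ry0 : rcons r y != [::] by case: (r).
exists (rcons r y) => //; apply: Proper_pins_step => //.
apply: (best_pin_sub ry0 rqy bx); apply: separates_pin => //.
have := hull_sub s ry0 rqy; case: bx => /andP[+ _] _.
by rewrite /in_rect /=; lia.
Qed.

Lemma proper_reaches z : simple_perm s -> extreme_point s z ->
  z != p1 -> z != p2 -> exists q, proper_pins q z.
Proof.
move=> simp ext z1 z2; have [q gq bz] := greedy_reaches simp ext z1 z2.
by have [r pr _] := greedy_proper gq bz; exists r.
Qed.

Lemma proper_cons q z : proper_pins q z -> exists q', rcons q z = [:: p1, p2 & q'].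
Proof.
elim=> [|{}q i x _ [q' e] _ _]; first by exists [::].
by exists (rcons q' x); rewrite e.
Qed.

Lemma proper_uniq q z : proper_pins q z -> uniq (rcons q z).
Proof.
elim=> [|{}q i x _ u [/pin_notin h _] _]; first by rewrite /= inE p12.
by rewrite rcons_uniq h.
Qed.

Lemma proper_cut q z q1 y q2 : proper_pins q z -> rcons q z = q1 ++ y :: q2 ->
  q1 != [::] ->
  [/\ proper_pins q1 y, q1 = [:: p1] /\ y = p2 \/ 1 < size q1 /\ best_pin s q1 y
    & forall x q3, q2 = x :: q3 -> separates (pt s x) (hull s q1) (pt s y)].
Proof.
move=> pq; elim: pq q1 y q2 => [|{}q i x pq IH bx sep] q1 y q2.
  case: q1 => [|a [|b q1]] //=.
    by case=> <- <- <- _; split; [exact: Proper_pins_start|left|].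
  by case=> _ _; case: q1.
case/lastP: q2 => [|q2 w].
  rewrite cats1 => /rcons_inj[<- <-] _; split=> //; first exact: Proper_pins_step.
  by right; split=> //; rewrite size_rcons; case: (q) (proper_neq0 pq).
rewrite -rcons_cons -rcons_cat => /rcons_inj[e xw] q10; subst w.
have [h1 h2 h3] := IH _ _ _ e q10; split=> // w q3.
case: q2 e h3 => [|v q2] e h3 /=; last by case=> <- _; apply: h3.
case=> <- _; move: e; rewrite cats1 => /rcons_inj[<- <-]; exact: sep.
Qed.

Lemma proper_cut_sequence q z : proper_pins q z ->
  cut_sequence (@pos n) (entry s) (rcons q z).
Proof.
move=> pq q1 y q2 e s1; have q10 : q1 != [::] by case: q1 s1 e.
case: (proper_cut pq e q10) => _ [[h _]|[_ [pin _]]] _; first by rewrite h in s1.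
exact: is_pin_cuts.
Qed.

Lemma proper_pin_sequenceP q z : proper_pins q z ->
  proper_pin_sequence s [seq pt s i | i <- rcons q z].
Proof.
move=> pq; set p := rcons q z.
have split_at (j : nat) : j < size p ->
    p = take j p ++ nth z p j :: drop j.+1 p.
  by move=> jp; rewrite -drop_nth // cat_take_drop.
have nz (j : nat) : 0 < j -> j < size p -> take j p != [::].
  by move=> j0 jp; rewrite -size_eq0 size_take jp; lia.
have nthE (j : nat) : j < size p -> nth (0, 0) [seq pt s i | i <- p] j = pt s (nth z p j).
  by move=> jp; rewrite (nth_map z).
have best (j : nat) : 2 <= j < size p -> best_pin s (take j p) (nth z p j).
  case/andP=> j2 jp; case: (proper_cut pq (split_at j jp)).
  - by apply: nz => //; lia.
  - by move=> _ [[h _]|[]] //; have := congr1 size h; rewrite size_takel /=; lia.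
split; first split.
- by rewrite map_inj_uniq ?proper_uniq //; exact: pt_inj.
- by move=> _ /mapP[i _ ->]; exact: mem_plot.
- move=> j; rewrite size_map => jp; rewrite nthE -?map_take -?hullE; last by lia.
  by case: (best j jp).
- move=> j d; rewrite size_map => jp; rewrite nthE -?map_take -?hullE; last by lia.
  by move=> pin _ /codomP[i ->]; case: (best j jp) => _; apply.
move=> j j1; rewrite size_map => jp.
rewrite !nthE -?map_take -?hullE; try lia.
have jp' : j < size p by lia.
case: (proper_cut pq (split_at j jp')); first exact: nz.
by move=> _ _; apply; rewrite (drop_nth z jp).
Qed.

End PinSequences.

(** * Many pin sequences with a common end *)

Lemma large_fiber (I C : finType) (f : I -> C) (S : {set I}) K :
  #|f @: S| * K < #|S| -> exists c, K < #|[set i in S | f i == c]|.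
Proof.
move=> lt; apply: NNPP => none; move: lt; apply/negP; rewrite -leqNgt.
rewrite -sum1_card (partition_big_imset f) /= -sum_nat_const leq_sum // => c _.
rewrite (_ : \sum_(i in S | f i == c) 1 = #|[set i in S | f i == c]|).
  by rewrite leqNgt; apply/negP => h; apply: none; exists c.
by rewrite -sum1_card; apply: eq_bigl => i; rewrite inE.
Qed.

(** The words [g i] of length [h] form a tree. With at most [D] children at each node it has at most
    [D ^ h] leaves, so some node at depth [l] has more; [B] consists of indices of words through
    that node. *)
Lemma branching (I C : finType) D h (g : I -> nat -> C) (A : {set I}) :
  {in A &, forall i j, (forall l, l < h -> g i l = g j l) -> i = j} ->
  D ^ h < #|A| ->
  exists l (B : {set I}), [/\ l < h, B \subset A,
    {in B &, forall i j l', l' < l -> g i l' = g j l'}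
    & D < #|[set g i l | i in B]|].
Proof.
elim: h g A => [|h IH] g A inj lt.
  move: lt; rewrite expn0 => /card_gt1P[i [j [iA jA]]].
  by rewrite (inj i j) ?eqxx.
have [many|few] := ltnP D #|[set g i 0 | i in A]|.
  by exists 0, A; split=> // i j _ _ l'.
have [|c cA] := @large_fiber _ _ (fun i => g i 0) A (D ^ h).
  by apply: leq_ltn_trans lt; rewrite expnS leq_mul2r few orbT.
have [|l [B [lh sB agree many]]] := IH (fun i l => g i l.+1) _ _ cA.
  move=> i j; rewrite !inE => /andP[iA /eqP gi] /andP[jA /eqP gj] e.
  by apply: inj => // -[|l] //= lh; [rewrite gi gj|apply: e].
exists l.+1, B; split=> //.
  by apply: subset_trans sB _; apply/subsetP => i; rewrite inE => /andP[].
move=> i j iB jB [|l'] //= ll; last exact: agree.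
by have := subsetP sB i iB; have := subsetP sB j jB;
  rewrite !inE => /andP[_ /eqP->] /andP[_ /eqP->].
Qed.

(** The right side is the number of starting pairs, the left side the capacity of a tree of depth
    [2 * k] and branching at most [M ^ 2]. *)
Lemma tower_bound k M : 0 < k -> 2048 <= M -> (M ^ 2) ^ (2 * k) < (M ^ (M ^ (2 * k))).-1.
Proof.
move=> k0 hM; have M1 : 1 < M by lia.
have h1 : (4 * k).+1 <= M ^ (2 * k).
  have := ltn_expl (2 * k).-1 M1; rewrite -[in M ^ (2 * k)](prednK (n := 2 * k)); last lia.
  by rewrite expnS; nia.
have h2 : M ^ (4 * k).+1 <= M ^ (M ^ (2 * k)) by rewrite leq_exp2l.
have h3 : 0 < M ^ (4 * k) by rewrite expn_gt0; lia.
rewrite -expnM (_ : 2 * (2 * k) = 4 * k); last lia.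
move: h2; rewrite expnS; nia.
Qed.

(** Six is the number of classes in [pin_class], and the other factor is the class size that
    [pin_class_target] asks for. *)
Lemma class_bound k : 0 < k ->
  6 * (((2 * k ^ 2) ^ 2) ^ 2) ^ 2 < (2048 * k ^ 8) ^ 2.
Proof.
move=> k0; rewrite -!expnM (expnMn 2 (k ^ 2)) (expnMn 2048 (k ^ 8)).
rewrite -(expnM k 2) -(expnM k 8).
rewrite (_ : 2 * (2 * (2 * 2)) = 8 * 2) // (_ : 2 ^ (2 * (2 * 2)) = 256) //.
have : 0 < k ^ (8 * 2) by rewrite expn_gt0 k0.
by rewrite (_ : 2048 ^ 2 = 2048 * 2048) //; lia.
Qed.

Lemma proper_pin_sequence_take n (s : 'S_n) p m :
  proper_pin_sequence s p -> proper_pin_sequence s (take m p).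
Proof.
case=> -[u sub pin] best sep.
have sz j : j < size (take m p) -> [/\ j < size p, take j (take m p) = take j p
    & nth (0, 0) (take m p) j = nth (0, 0) p j].
  rewrite size_take_min leq_min => /andP[jm jp].
  by rewrite take_takel ?nth_take // ltnW.
split; first split.
- exact: take_uniq.
- by move=> q /mem_take/sub.
- by move=> j /andP[j2 /sz[jp -> ->]]; apply: pin; rewrite j2.
- by move=> j d /andP[j2 /sz[jp -> ->]]; apply: best; rewrite j2.
move=> j j1 jm; have [_ -> ->] := sz j (ltnW jm); have [jp _ ->] := sz _ jm.
exact: sep.
Qed.

Lemma split_before (T : eqType) z (w : seq T) l : 0 < l < size w ->
  w = take l.-1 w ++ nth z w l.-1 :: nth z w l :: drop l.+1 w.
Proof.
case/andP=> l0 lw; rewrite -(drop_nth z lw).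
have e : drop l.-1 w = nth z w l.-1 :: drop l w.
  by rewrite (drop_nth z) ?prednK //; lia.
by rewrite -e cat_take_drop.
Qed.

(* Classes 0 to 3 are the four directions in which [x] can separate [y] from a
   rectangle; in the last two [y] is the second point of a pair of adjacent
   columns, [g y] being the first. *)
Definition pin_class n (s : 'S_n) (x : 'I_n) (g : 'I_n -> 'I_n) (c : nat) (y : 'I_n) : Prop :=
  match c with
  | 0 => pinned (@pos n) (entry s) x y
  | 1 => pinned (flip (@pos n)) (entry s) x y
  | 2 => pinned (entry s) (@pos n) x y
  | 3 => pinned (flip (entry s)) (@pos n) x y
  | 4 => odd y /\ entry s (g y) < entry s x < entry s y
  | _ => odd y /\ entry s y < entry s x < entry s (g y)
  end.

Lemma pin_class_target n (s : 'S_n) k x (g : 'I_n -> 'I_n) c (S : {set 'I_n}) : 1 < k ->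
  (forall y, g y = y.-1 :> nat) -> short_reach k (@pos n) (entry s) ->
  {in S, forall y, pin_class s x g c y} ->
  (((2 * k ^ 2) ^ 2) ^ 2) ^ 2 <= #|S| -> has_target k (@pos n) (entry s).
Proof.
move=> k1 gE R hS sz.
have injX := @pos_inj n; have injY := @entry_inj n s.
have sz' : ((2 * k ^ 2) ^ 2) ^ 2 <= #|S|.
  apply: leq_trans sz; rewrite [leqRHS]expnS expn1 leq_pmulr //.
  by rewrite !expn_gt0 muln_gt0 expn_gt0 (ltnW k1).
have adjacent : {in S, forall y : 'I_n, odd y} ->
    {in S, forall y, entry s (g y) < entry s x < entry s y} \/
    {in S, forall y, entry s y < entry s x < entry s (g y)} ->
    has_target k (@pos n) (entry s).
  move=> oS h; apply: (successor_pairs_target k1 injX injY R (g := g) (x := x) _ _ h sz').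
  (* Oddness of the 0-based index makes the pairs of adjacent columns disjoint. *)
  - by move=> y /oS; rewrite /pos gE; lia.
  - by move=> y z /oS oy /oS oz; rewrite /pos gE; lia.
case: c hS => [|[|[|[|[|c]]]]] hS.
- exact: (pinned_target k1 injX injY R hS sz).
- apply: has_target_flipX.
  exact: (pinned_target k1 (flip_inj injX) injY (short_reach_flipX R) hS sz).
- apply: has_target_swap.
  exact: (pinned_target k1 injY injX (short_reach_swap R) hS sz).
- apply/has_target_swap/has_target_flipX.
  exact: (pinned_target k1 (flip_inj injY) injX (short_reach_flipX (short_reach_swap R)) hS sz).
- by apply: adjacent; [|left] => y /hS[].
- by apply: adjacent; [|right] => y /hS[].
Qed.

Lemma short_reach_of_proper n (s : 'S_n) k : 1 < k -> simple_perm s ->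
  (forall p, proper_pin_sequence s p -> size p < 2 * k) ->
  short_reach k (@pos n) (entry s).
Proof.
move=> k1 simp short p1 p2 z p12 ez.
have [zp|] := boolP (z \in [:: p1; p2]).
  exists [::]; split=> //; first by rewrite /=; lia.
  by case=> [|a [|b [|c q1]]] p q2.
rewrite !inE negb_or => /andP[z1 z2].
have [q pq] := proper_reaches p12 simp ez z1 z2.
have [q' e] := proper_cons pq; exists q'; rewrite -e; split.
- by have := short _ (proper_pin_sequenceP p12 pq); rewrite size_map.
- by rewrite mem_rcons mem_head.
exact: proper_cut_sequence pq.
Qed.

Lemma short_pins_target n (s : 'S_n) k : 1 < k -> simple_perm s ->
  2 * (2048 * k ^ 8) ^ ((2048 * k ^ 8) ^ (2 * k)) <= n ->
  (forall p, proper_pin_sequence s p -> size p < 2 * k) ->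
  has_target k (@pos n) (entry s).
Proof.
move=> k1 simp; set M := 2048 * k ^ 8; set N := M ^ _ => nN short.
have k0 : 0 < k by lia.
have M0 : 2048 <= M by rewrite /M leq_pmulr // expn_gt0 k0.
have bound := tower_bound k0 M0; have R := short_reach_of_proper k1 simp short.
rewrite -/N in bound.
have n0 : n.-1 < n by lia.
pose z := Ordinal n0.
(* Using [N.-1] pairs of columns instead of [N] keeps all of them away from the last column, that of
   [z]. *)
have ltv (i : 'I_(N.-1)) : 2 * i + 1 < n by have := ltn_ord i; lia.
have ltu (i : 'I_(N.-1)) : 2 * i < n by have := ltv i; lia.
pose u i := Ordinal (ltu i); pose v i := Ordinal (ltv i).
have uv i : u i != v i by apply/negP => /eqP[]; lia.
have /fin_all_exists[Q hQ] i : exists q, proper_pins s (u i) (v i) q z.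
  apply: proper_reaches => //.
  - by apply: Or41 => j; rewrite /pos /=; have := ltn_ord j; lia.
  - by apply/negP => /eqP[] /=; have := ltn_ord i; lia.
  - by apply/negP => /eqP[] /=; have := ltn_ord i; lia.
(* The pin sequence read backwards from [z], without [u i]; its last letter [v i] determines [i]. *)
pose w i := rev (behead (rcons (Q i) z)).
have wE i : rcons (Q i) z = u i :: rev (w i).
  by rewrite /w revK; have [q ->] := proper_cons (hQ i).
have wlast i : last z (w i) = v i.
  by rewrite /w; have [q ->] := proper_cons (hQ i); rewrite /= rev_cons last_rcons.
have wsize i : size (w i) < 2 * k.
  have := short _ (proper_pin_sequenceP (uv i) (hQ i)).
  by rewrite size_map wE /= size_rev; lia.
have w0 i : nth None (map Some (w i)) 0 = Some z.
  rewrite /w; have [q e] := proper_cons (hQ i); rewrite e /=.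
  have : last z (rcons (Q i) z) = z by rewrite last_rcons.
  rewrite e /=; case/lastP: q {e} => [|q a] /=; first by move->.
  by rewrite last_rcons => ->; rewrite -rcons_cons rev_rcons.
(* Padding by [None] allows words of different lengths in one tree of depth [2 * k]. *)
pose gg i l := nth None (map Some (w i)) l.
have gS i l : l < size (w i) -> gg i l = Some (nth z (w i) l).
  by move=> lw; rewrite /gg (nth_map z).
have gN i l : size (w i) <= l -> gg i l = None.
  by move=> lw; rewrite /gg nth_default ?size_map.
have gE i l y : gg i l = Some y -> l < size (w i) /\ nth z (w i) l = y.
  by have [/gN -> //|lw] := leqP (size (w i)) l; rewrite gS // => -[].
have [||l [B [lk _ agree many]]] :=
    @branching _ _ (M ^ 2) (2 * k) gg [set: 'I_(N.-1)].
- move=> i j _ _ e.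
  have le i' j' : (forall l, l < 2 * k -> gg i' l = gg j' l) -> size (w i') <= size (w j').
    move=> e'; rewrite leqNgt; apply/negP => h.
    by have := e' _ (ltn_trans h (wsize i')); rewrite gS ?gN.
  have sz : size (w i) = size (w j).
    by apply/eqP; rewrite eqn_leq !le // => l lk; rewrite e.
  have we : w i = w j.
    apply: (@eq_from_nth _ z) => // l lw; apply: Some_inj.
    by rewrite -!gS ?e -?sz //; apply: ltn_trans lw (wsize i).
  have : v i = v j by rewrite -!wlast we.
  by case=> h; apply: val_inj => /=; lia.
- by rewrite cardsT card_ord.
(* All words begin with [z], so there is no branching at the root. *)
have l0 : 0 < l.
  rewrite lt0n; apply/negP => /eqP l0; move: many; apply/negP; rewrite -leqNgt.
  apply: (@leq_trans #|[set Some z]|); last by rewrite cards1 expn_gt0; lia.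
  apply/subset_leq_card/subsetP => _ /imsetP[i _ ->].
  by rewrite l0 inE /gg w0.
(* Discarding the letter [None] costs at most one, so at least [M ^ 2] of the branches are
   points. *)
pose S := [set y | Some y \in [set gg i l | i in B]].
have cardS : M ^ 2 <= #|S|.
  rewrite -(card_imset _ (@Some_inj _)) -ltnS; apply: leq_trans many _.
  apply: (@leq_trans #|None |: [set Some y | y in S]|); last first.
    by rewrite cardsU1 -add1n leq_add2r leq_b1.
  apply/subset_leq_card/subsetP => -[y|] yB; rewrite !inE //.
  by apply/orP; right; apply/imsetP; exists y; rewrite ?inE.
have [y0] : exists y, y \in S.
  by apply/set0Pn; rewrite -card_gt0; apply: leq_trans cardS; rewrite expn_gt0; lia.
rewrite inE => /imsetP[i0 i0B /esym/gE[lw0 _]].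
(* Words from [B] agree before depth [l], so [x] is the common pin that follows every [y] in [S]. *)
pose x := nth z (w i0) l.-1.
have pred_lt (y : 'I_n) : y.-1 < n by apply: leq_ltn_trans (leq_pred y) (ltn_ord y).
pose g y := Ordinal (pred_lt y).
have /fin_all_exists[c hc] y : exists c : 'I_6, y \in S -> pin_class s x g c y.
  case: (boolP (y \in S)) => [|_]; last by exists ord0.
  rewrite inE => /imsetP[i iB /esym/gE[lw ye]].
  have xe : nth z (w i) l.-1 = x.
    have := agree _ _ i0B iB l.-1; rewrite prednK // => /(_ (leqnn _)).
    by rewrite !gS; try lia; case.
  have lw' : 0 < l < size (w i) by rewrite l0.
  have := wE i; rewrite (split_before z lw') ye xe rev_cat !rev_cons !cat_rcons.
  set r1 := rev (drop _ _); set r2 := rev (take _ _) => e.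
  have {}e : rcons (Q i) z = (u i :: r1) ++ y :: x :: r2 by rewrite e.
  have [_ h sep] := proper_cut (hQ i) e isT.
  have {}sep := sep _ _ erefl.
  case: h => [[qe yv]|[_ best]].
    have gy : g y = u i by apply: val_inj; rewrite yv /=; lia.
    have oy : odd y by rewrite yv /=; lia.
    move: sep; rewrite qe /separates /=.
    case: (@hull_attained n s [:: u i]) => //.
    move=> [j1 + <-] [j2 + <-] [j3 + <-] [j4 + <-].
    rewrite !inE => /eqP-> /eqP-> /eqP-> /eqP-> /or4P[]h.
    (* No column lies strictly between the adjacent columns of [u i] and [v i], so only vertical
       separation remains. *)
    - by move: h; rewrite yv /pos /=; lia.
    - by move: h; rewrite yv /pos /=; lia.
    - by exists (inord 4) => _; rewrite inordK //= gy; split.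
    - by exists (inord 5) => _; rewrite inordK //= gy; split.
  have q0 : u i :: r1 != [::] by [].
  by case: (best_pin_pinned q0 best sep) => h;
    [exists (inord 0)|exists (inord 1)|exists (inord 2)|exists (inord 3)] => _;
    rewrite inordK.
have [|c0 big] := @large_fiber _ _ c S ((((2 * k ^ 2) ^ 2) ^ 2) ^ 2).
  apply: leq_trans cardS; apply: leq_ltn_trans (class_bound k0).
  by rewrite leq_mul2r -[X in _ <= X]card_ord max_card orbT.
apply: (pin_class_target k1 _ R (x := x) (g := g) (c := c0) _ (ltnW big)) => // y.
by rewrite inE => /andP[/hc + /eqP <-].
Qed.

Theorem theorem4p5 (k : nat) (hk : 0 < k) (n : nat) (s : 'S_n)
    (hs : simple_perm s)
    (hn : 2 * (2048 * k ^ 8) ^ ((2048 * k ^ 8) ^ (2 * k)) <= n) :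
  [\/ exists p : seq point, proper_pin_sequence s p /\ size p = 2 * k,
      exists t : 'S_(2 * k), parallel_alternation t /\ contains s t
    | exists t : 'S_(2 * k), wedge_simple t /\ contains s t].
Proof.
have [[p [hp kp]]|short] := classic (exists p, proper_pin_sequence s p /\ 2 * k <= size p).
  apply: Or31; exists (take (2 * k) p); rewrite size_takel //; split=> //.
  exact: proper_pin_sequence_take.
have {}short p : proper_pin_sequence s p -> size p < 2 * k.
  by move=> hp; rewrite ltnNge; apply/negP => h; apply: short; exists p.
(* For [k = 1] any two distinct points already form a proper pin sequence of length 2. *)
have k1 : 1 < k.
  rewrite ltnNge; apply/negP => k1.
  have n2 : 2 <= n.
    by apply: leq_trans hn; rewrite leq_pmulr // expn_gt0 muln_gt0 expn_gt0 hk.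
  pose i := Ordinal (ltnW n2); pose j := Ordinal n2.
  have ij : i != j by [].
  have := short _ (proper_pin_sequenceP ij (Proper_pins_start s i j)).
  by rewrite /=; lia.
have [t [ht [f [f1 f2]]]] := short_pins_target k1 hs hn short.
have ct : contains s t by exists f; split=> // a b /f1.
by case: ht => ht; [apply: Or32|apply: Or33]; exists t.
Qed.
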